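(* Let $u=v^{\gamma,\delta}$ with $0\le\gamma<\frac14$, $0\le\delta<\frac14$. Assume that for some $s>0$ $$\sup_{|x|\le1}\|k_x\|_{Z_s(u\varphi)}<+\infty,\qquad \sup_{|y|\le1}(u\varphi)(y)\int_{-1}^1|h(x,y)|u^{-1}(x)\,dx<+\infty,$$ $$\sup_{y\in I_\tau}(u\varphi)(y)\int_{-1}^1|\Delta_{\tau\varphi(y)}h(x,y)|u^{-1}(x)\,dx<\mathcal C_0\,\tau^s$$ with $\mathcal C_0>0$ independent of $\tau$, that $g\in Z_s(u\varphi)$, $\sigma\varphi\in Z_s$, and that $\mathrm{Ker}(DA^\varphi+K+H)=\{0\}$ and $\mathrm{Ker}(M_{\sigma\varphi}+DA^\varphi+K+H)=\{0\}$ in $Z_r(u\varphi)$, with $1<r<s+1$. Then, denoting by $\mathrm{cond}(\bar{\mathbf A}_m)$ the condition number in infinity norm of the matrix $\bar{\mathbf A}_m$ defined in the context, for all sufficiently large $m$ $$\mathrm{cond}(\bar{\mathbf A}_m)\le\mathcal C\,\left\|\left((L_m^\varphi M_{\sigma\varphi}+DA^\varphi+L_m^\varphi K_m+L_m^\varphi H)_{|\mathbb P_{m-1}}\right)^{-1}\right\|_{C_{u\varphi}\to C_{u\varphi}}\,m\log^3m,$$ where $\mathcal C$ is independent of $m$.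
   Context: Weights and spaces. For real $a,b$ let $v^{a,b}(x)=(1-x)^a(1+x)^b$, and let $\varphi(x)=\sqrt{1-x^2}$. For a weight $v=v^{a,b}$ with $a,b\ge0$, $C_v$ is the space of real functions $f$ continuous on $(-1,1)$, continuous also at $1$ if $a=0$ and at $-1$ if $b=0$, with $\lim_{x\to1^-}(fv)(x)=0$ if $a>0$ and $\lim_{x\to-1^+}(fv)(x)=0$ if $b>0$; its norm is $\|f\|_{C_v}=\|fv\|_\infty=\max_{|x|\le1}|(fv)(x)|$. For an integer $n\ge1$, $$\Omega_\varphi^n(f,t)_v=\sup_{0<\tau\le t}\ \max_{x\in I_{n\tau}}|v(x)\Delta^n_{\tau\varphi}f(x)|,\qquad I_{n\tau}=[-1+(2n\tau)^2,1-(2n\tau)^2],$$ (values of $\tau$ with empty $I_{n\tau}$ are ignored), where $\Delta^n_{\tau\varphi}f(x)=\sum_{i=0}^n(-1)^i\binom ni f\left(x+\frac{\tau\varphi(x)}2(n-2i)\right)$. For real $r>0$, fixing an integer $n>r$, $Z_r(v)=\{f\in C_v:\sup_{t>0}t^{-r}\Omega^n_\varphi(f,t)_v<\infty\}$ with norm $\|f\|_{Z_r(v)}=\|fv\|_\infty+\sup_{t>0}t^{-r}\Omega^n_\varphi(f,t)_v$ (different $n$ give the same space with equivalent norms). $Z_0(v):=C_v$, and $Z_r:=Z_r(v^{0,0})$. $\mathbb P_m$ is the space of algebraic polynomials of degree at most $m$. Operators (this is the case $\alpha=\frac12$, where the weights $\rho=v^{\alpha,1-\alpha}$ and $w=v^{1-\alpha,\alpha}$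 equal $\varphi$, $a=\cos\pi\alpha=0$, $b=-\sin\pi\alpha=-1$). $\sigma$ is a given function on $(-1,1)$, $(M_{\sigma\varphi}f)(y)=\sigma(y)\varphi(y)f(y)$, $D=\frac{d}{dy}$, $$(A^\varphi f)(y)=-\frac1\pi\int_{-1}^1\frac{(f\varphi)(x)}{x-y}dx\quad\text{(Cauchy principal value)},$$ $$(Kf)(y)=\frac1\pi\int_{-1}^1k(x,y)(f\varphi)(x)dx,\qquad (Hf)(y)=\frac1\pi\int_{-1}^1h(x,y)(f\varphi)(x)dx.$$ Here $k,h$ are given real kernels (a smooth one and a weakly singular one, informally; the quantitative assumptions are those in the claim), measurable in $x$. $k_x$ denotes $y\mapsto k(x,y)$ and $k_y$ denotes $x\mapsto k(x,y)$. In the suprema over $|y|\le1$ a product is taken to be $0$ at $y=\pm1$, where $u\varphi$ vanishes. For $h$: $\Delta_{\tau\varphi(y)}h(x,y)=h\left(x,y+\frac{\tau\varphi(y)}2\right)-h\left(x,y-\frac{\tau\varphi(y)}2\right)$ and $I_\tau=[-1+(2\tau)^2,1-(2\tau)^2]$, for $0<\tau\le\frac12$. Interpolation. $p_j^\varphi$ is the orthonormal polynomial of degree $j$ with respect to the weight $\varphi$ on $[-1,1]$ with positive leading coefficient; $x_1,\dots,x_m$ are the zeros of $p_m^\varphi$ and $\lambda^\varphi_{m,1},\dots,\lambda^\varphi_{m,m}$ the corresponding Christoffel numbers (Gauss quadrature weights with respect to $\varphi$). $L_m^\varphi G\in\mathbb P_{m-1}$ is the polynomial interpolating $G$ at $x_1,\dots,x_m$,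 and $(K_mf)(y)=\frac1\pi\int_{-1}^1L_m^\varphi(k_y,x)(f\varphi)(x)dx$. The matrix. With $c_j(y)=\int_{-1}^1h(x,y)p_j^\varphi(x)\varphi(x)dx$, set $\bar{\mathbf A}_m=\mathbf\Gamma_m+\mathbf A_m$, where $\mathbf\Gamma_m=\mathrm{diag}((\sigma\varphi)(x_1),\dots,(\sigma\varphi)(x_m))$ and, for $i,k=1,\dots,m$, $$\mathbf A_m(i,k)=(u\varphi)(x_i)\,\frac{\lambda^\varphi_{m,k}}{(u\varphi)(x_k)}\left[\sum_{j=0}^{m-1}p_j^\varphi(x_k)\left((j+1)p_j^\varphi(x_i)+\frac1\pi c_j(x_i)\right)+\frac1\pi k(x_k,x_i)\right].$$ It is the matrix of the linear system, in the unknowns $\bar a_k=(u\varphi f_m)(x_k)$, obtained by multiplying by $u\varphi$ and collocating at $x_1,\dots,x_m$ the equation $(L_m^\varphi M_{\sigma\varphi}+DA^\varphi+L_m^\varphi K_m+L_m^\varphi H)f_m=L_m^\varphi g$, $f_m\in\mathbb P_{m-1}$. $\mathrm{cond}(\bar{\mathbf A}_m)=\|\bar{\mathbf A}_m\|_\infty\|\bar{\mathbf A}_m^{-1}\|_\infty$. The norm on the right-hand side is the operator norm of the inverse on $(\mathbb P_{m-1},\|\cdot\|_{C_{u\varphi}})$.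
   Formalization: The inverse on the right need not exist under the stated assumptions (k may be irregular in x at the nodes), so existence is not asserted: its norm is read as +∞ when the operator is not invertible on P_{m-1}, and cond of a singular matrix as +∞. *)

(* Defs.v *)
From mathcomp Require Import all_boot all_order all_algebra.
From mathcomp Require Import all_classical all_reals all_analysis.

Set Implicit Arguments.
Unset Strict Implicit.
Unset Printing Implicit Defensive.

Import Order.TTheory GRing.Theory Num.Theory.
Import numFieldNormedType.Exports.

Local Open Scope classical_set_scope.
Local Open Scope ring_scope.

(** * Jacobi weights and weighted spaces

    A function on [(-1, 1)] (or on [[-1, 1]]) is represented by a total
    [f : R -> R] whose values off its domain are irrelevant. *)

Section Spaces.
Context {R : realType}.
Implicit Types (a b r t : R) (f : R -> R) (n : nat).

Definition jacobi a b (x : R) : R := (1 - x) `^ a * (1 + x) `^ b.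

Definition phi (x : R) : R := Num.sqrt (1 - x ^+ 2).

(* Since phi is the Jacobi weight of exponents (1/2, 1/2), the product u phi
   with u = jacobi c d is the Jacobi weight of exponents (c + 1/2, d + 1/2). *)
Lemma jacobi_phi c d (x : R) : 0 <= c -> 0 <= d -> x \in `[-1, 1] ->
  jacobi c d x * phi x = jacobi (c + 2^-1) (d + 2^-1) x.
Proof.
move=> c0 d0; rewrite in_itv/= => /andP[x1 x2].
have ge1 : 0 <= 1 - x by rewrite subr_ge0.
have ge2 : 0 <= 1 + x by rewrite -lerBlDl sub0r.
have c2 : c + 2^-1 != 0 by rewrite gt_eqF// ltr_wpDl// invr_gt0.
have d2 : d + 2^-1 != 0 by rewrite gt_eqF// ltr_wpDl// invr_gt0.
rewrite /jacobi !powRD ?(negbTE c2) ?(negbTE d2)// /phi.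
have -> : 1 - x ^+ 2 = (1 - x) * (1 + x).
  by rewrite -{1}(expr1n _ 2) subr_sqr.
by rewrite sqrtrM// !powR12_sqrt// mulrACA.
Qed.

(* The norm of C_v for v = jacobi a b. If a > 0 the weight is 0 at 1, so that
   the irrelevant value [f 1] contributes 0; likewise at -1. *)
Definition Cnorm a b f : \bar R :=
  ereal_sup [set (`|f x * jacobi a b x|)%:E | x in `[-1, 1]].

Definition Cspace a b f : Prop :=
  [/\ {in `]-1, 1[, continuous f},
      a = 0 -> f x @[x --> 1^'-] --> f 1,
      b = 0 -> f x @[x --> (-1)^'+] --> f (-1),
      0 < a -> f x * jacobi a b x @[x --> 1^'-] --> (0 : R) &
      0 < b -> f x * jacobi a b x @[x --> (-1)^'+] --> (0 : R)].

Definition Delta n (tau : R) f (x : R) : R :=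
  \sum_(i < n.+1) (-1) ^+ i * 'C(n, i)%:R *
    f (x + tau * phi x / 2 * (n%:R - 2 * i%:R)).

(* The interval I_tau; the n-th modulus uses I_(n tau). *)
Definition Iset (tau : R) : set R :=
  `[-1 + (2 * tau) ^+ 2, 1 - (2 * tau) ^+ 2].

(* The supremum of the empty set is -oo in \bar R, so the tau for which
   I_(n tau) is empty are ignored. *)
Definition Omega n a b f t : \bar R :=
  ereal_sup [set
    ereal_sup [set (`|jacobi a b x * Delta n tau f x|)%:E
              | x in Iset (n%:R * tau)]
  | tau in `]0, t]].

Definition Zseminorm n r a b f : \bar R :=
  ereal_sup [set ((t `^ (- r))%:E * Omega n a b f t)%E | t in [set t | 0 < t]].

(* The space Z_r(v) for v = jacobi a b, r > 0, built with differences of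
   order n > r. *)
Definition Zspace n r a b f : Prop :=
  Cspace a b f /\ (Zseminorm n r a b f < +oo)%E.

Definition Znorm n r a b f : \bar R := (Cnorm a b f + Zseminorm n r a b f)%E.

End Spaces.

(** * Operators *)

Section Operators.
Context {R : realType}.
Implicit Types (f G sigma : R -> R) (k h : R -> R -> R) (y : R).

Let mu := @lebesgue_measure R.

Definition Mop sigma f y : R := sigma y * phi y * f y.

(* The integral is a Cauchy principal value. *)
Definition Aphi f y : R :=
  - pi^-1 * lim ((\int[mu]_(x in [set x | x \in `[-1, 1] /\ e < `|x - y|])
                    (f x * phi x / (x - y)))%R @[e --> 0^'+]).

Definition DAphi f y : R := derive1 (Aphi f) y.

(* K for the kernel k, H for the kernel h. *)
Definition Kop k f y : R :=
  pi^-1 * (\int[mu]_(x in `[-1, 1]) (k x y * (f x * phi x)))%R.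

(* Measurability of [k(., y)] on [[-1, 1]] for every y. *)
Definition measurable_in_x k : Prop :=
  forall y, y \in `]-1, 1[ ->
    measurable_fun (`[-1, 1]%classic : set (measurableTypeR R))
      (k^~ y : measurableTypeR R -> measurableTypeR R).

(* Ker T = {0} in Z_r(jacobi a b). *)
Definition trivial_ker n (r a b : R) (T : (R -> R) -> R -> R) : Prop :=
  forall f, Zspace n r a b f ->
    {in `]-1, 1[, forall y, T f y = 0} -> {in `]-1, 1[, forall y, f y = 0}.

(** * Orthonormal polynomials, Gauss nodes and Lagrange interpolation *)

Definition orthonormal_phi (p : nat -> {poly R}) : Prop :=
  [/\ forall j, size (p j) = j.+1,
      forall j, 0 < lead_coef (p j) &
      forall i j, (\int[mu]_(x in `[-1, 1])
        ((p i).[x] * (p j).[x] * phi x))%R = (i == j)%:R].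

(* As the m nodes are pairwise distinct roots of a polynomial of degree m, they
   are all its zeros; their order is immaterial. *)
Definition zeros_of (p : nat -> {poly R}) (x : forall m, 'I_m -> R) : Prop :=
  forall m, injective (x m) /\ forall i : 'I_m, root (p m) (x m i).

Section Nodes.
Variables (m : nat) (x : 'I_m -> R).

Definition lagr (k : 'I_m) : {poly R} :=
  \prod_(j < m | j != k) ((x k - x j)^-1 *: ('X - (x j)%:P)).

Definition interp G : {poly R} := \sum_(k < m) G (x k) *: lagr k.

(* The Gauss weights: quadrature is integration of the interpolant. *)
Definition christoffel (k : 'I_m) : R :=
  (\int[mu]_(t in `[-1, 1]) ((lagr k).[t] * phi t))%R.

Definition Kmop k : (R -> R) -> R -> R :=
  Kop (fun t y => (interp (k^~ y)).[t]).

Definition Tm sigma k h f y : R :=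
  (interp (Mop sigma f)).[y] + DAphi f y
    + (interp (Kmop k f)).[y] + (interp (Kop h f)).[y].

Variable p : nat -> {poly R}.

Definition cj h (j : nat) y : R :=
  (\int[mu]_(t in `[-1, 1]) (h t y * (p j).[t] * phi t))%R.

Definition Gammam sigma : 'M[R]_m := diag_mx (\row_i (sigma (x i) * phi (x i))).

Definition Am (u : R -> R) k h : 'M[R]_m :=
  \matrix_(i, l)
    (u (x i) * phi (x i) * (christoffel l / (u (x l) * phi (x l))) *
     (\sum_(j < m) (p j).[x l] * (j.+1%:R * (p j).[x i] + pi^-1 * cj h j (x i))
      + pi^-1 * k (x l) (x i))).

Definition Abar (u : R -> R) sigma k h : 'M[R]_m := Gammam sigma + Am u k h.

End Nodes.
End Operators.

(** * Norms of matrices and of inverse operators *)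

Section Norms.
Context {R : realType}.

Definition mxnorm_inf m (A : 'M[R]_m) : R :=
  \big[Num.max/0]_(i < m) \sum_(j < m) `|A i j|.

(* As usual, the condition number of a singular matrix is +oo. *)
Definition cond_inf m (A : 'M[R]_m) : \bar R :=
  if A \in unitmx then (mxnorm_inf A * mxnorm_inf (invmx A))%:E else +oo%E.

(* [{poly_m R}] is the space of polynomials of degree at most m - 1. *)
Definition opnorm m (a b : R) (S : {poly_m R} -> {poly_m R}) : \bar R :=
  ereal_sup [set Cnorm a b (horner (S q))
            | q in [set q : {poly_m R} | (Cnorm a b (horner q) <= 1)%E]].

(* S is the restriction of T to polynomials of degree at most m - 1. *)
Definition restricts m (T : (R -> R) -> R -> R)
    (S : {poly_m R} -> {poly_m R}) : Prop :=
  forall q : {poly_m R},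
    {in `]-1, 1[, forall y, T (horner q) y = (S q : {poly R}).[y]}.

(* The operator norm, for the norm of C_v with v = jacobi a b, of the inverse of
   the restriction of T to polynomials of degree at most m - 1. There is at most
   one such inverse; if there is none the infimum is that of the empty set,
   i.e. the norm of the inverse is +oo, as usual. *)
Definition inv_opnorm m (a b : R) (T : (R -> R) -> R -> R) : \bar R :=
  ereal_inf [set opnorm a b S'
            | S' in [set S' : {poly_m R} -> {poly_m R} |
                exists S, [/\ restricts T S, cancel S S' & cancel S' S]]].

End Norms.

(* Main.v *)
From HB Require Import structures.
Require Import Defs.
From mathcomp Require Import all_boot all_order all_algebra.
From mathcomp Require Import all_classical all_reals all_analysis.
From mathcomp Require Import ring lra zify.
Import Order.TTheory GRing.Theory Num.Theory.
Import numFieldNormedType.Exports.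
Local Open Scope classical_set_scope.
Local Open Scope ring_scope.

Set Implicit Arguments.
Unset Strict Implicit.
Unset Printing Implicit Defensive.

(** Orthonormality forces [p_j = sqrt (2 / pi) U_j], the Chebyshev polynomials of
    the second kind, so the nodes are [cos theta_l] with
    [theta_l = l pi / (m + 1)], and an explicit antiderivative of the principal
    value gives [DA p_j = (j + 1) p_j]. Hence, for [q] of degree less than [m]
    and [v_l = (u phi q)(x_l)], Gauss quadrature yields
    [(Abar v)_i = (u phi)(x_i) (T q)(x_i)] with [T] the collocation operator.
    If [T] has an inverse on polynomials, [Abar ^-1 w] consists of the values of
    [u phi T^-1 Q] at the nodes, [Q] interpolating [w / (u phi)], so that
    [|Abar^-1| <= |T^-1| Lambda_m] with [Lambda_m] the weighted Lebesgue constant.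
    In the angles, [Lambda_m] is a sum over the nodes of Dirichlet kernels
    [D_m <= min (m, 1 / |sin ((theta_l - t) / 2)|)], and is [O(log m)]; Abel
    summation costs a factor [2 m] for the hypersingular part, so
    [|Abar| = O(m log m)]. *)

(** The obstacle is the quotient [u y / u (x i)] inside every row sum: it is unbounded as nodes
    approach an endpoint, so bounds on the kernels alone do not suffice. In half angles, with
    [x i = cos a], [y = cos t] and exponents in [0, 1/2], the quotient is at most
    [3 + s / sin (a / 2) + s / cos (a / 2)], where [s = |sin ((a - t) / 2)|]. This [s] is exactly
    what the decay of the kernel absorbs; what is left are sums of [1 / sin (theta_l / 2)] and
    [1 / cos (theta_l / 2)] over the angles, which are again harmonic. The weight thus costs no
    additional logarithm.

    In a row of the matrix, [sigma phi] and [k] contribute O(1), the hypersingular part O(m log m),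
    and [h] contributes O(log m) through the weighted Lebesgue constant. Multiplied by the factor
    O(log m) from the inverse, this gives O(m log^2 m), which is below m log^3 m once m >= e. The
    estimate is proved for each inverse [S'] separately and then passed to the infimum, which is +oo
    if there is no inverse. *)

Section Chebyshev.
Context {R : realType}.
Implicit Types (x y t : R) (n : nat) (q : {poly R}).

Fixpoint chebU n : {poly R} :=
  if n is n1.+1 then
    if n1 is n2.+1 then 2%:P * 'X * chebU n1 - chebU n2 else 2%:P * 'X
  else 1.

Fixpoint chebT n : {poly R} :=
  if n is n1.+1 then
    if n1 is n2.+1 then 2%:P * 'X * chebT n1 - chebT n2 else 'X
  else 1.

Lemma chebUSS n : chebU n.+2 = 2%:P * 'X * chebU n.+1 - chebU n.
Proof. by []. Qed.

Lemma chebTSS n : chebT n.+2 = 2%:P * 'X * chebT n.+1 - chebT n.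
Proof. by []. Qed.

Lemma nat_ind2 (P : nat -> Prop) : P 0%N -> P 1%N ->
  (forall n, P n -> P n.+1 -> P n.+2) -> forall n, P n.
Proof.
move=> P0 P1 PS n; suff [] : P n /\ P n.+1 by [].
by elim: n => [//|n [Pn Pn1]]; split => //; exact: PS.
Qed.

Lemma sinS_rec n t :
  sin (n.+3%:R * t) = 2 * cos t * sin (n.+2%:R * t) - sin (n.+1%:R * t).
Proof.
have -> : n.+3%:R * t = n.+2%:R * t + t by rewrite -addn1 natrD; ring.
have -> : n.+1%:R * t = n.+2%:R * t - t by rewrite -(addn1 n.+1) natrD; ring.
by rewrite sinD sinB; ring.
Qed.

Lemma chebU_cos n t : (chebU n).[cos t] * sin t = sin (n.+1%:R * t).
Proof.
elim/nat_ind2: n => [||n IH0 IH1]; first by rewrite hornerC !mul1r.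
  by rewrite /= !hornerE (mulr_natl t) sin_mulr2n -[RHS]mulr_natl mulrA.
by rewrite chebUSS sinS_rec -IH0 -IH1 hornerD hornerN !hornerM hornerC hornerX; ring.
Qed.

Lemma size_lead_chebU n : size (chebU n) = n.+1 /\ lead_coef (chebU n) = 2 ^+ n.
Proof.
elim/nat_ind2: n => [||n [s0 l0] [s1 l1]].
- by rewrite size_poly1 lead_coef1.
- by rewrite /= size_Cmul ?pnatr_eq0// size_polyX lead_coefM lead_coefX lead_coefC mulr1.
rewrite chebUSS.
have sM : size (2%:P * 'X * chebU n.+1) = n.+3.
  rewrite -mulrA size_Cmul ?pnatr_eq0// mulrC size_mulX ?s1//.
  by rewrite -size_poly_gt0 s1.
have lt : (size (- chebU n)%R < size (2%:P * 'X * chebU n.+1)%R)%N.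
  by rewrite size_polyN s0 sM.
by rewrite size_polyDl// sM lead_coefDl// !lead_coefM l1 lead_coefC lead_coefX mulr1 -exprS.
Qed.

Lemma size_chebU n : size (chebU n) = n.+1.
Proof. by case: (size_lead_chebU n). Qed.

Lemma lead_coef_chebU n : lead_coef (chebU n) = 2 ^+ n.
Proof. by case: (size_lead_chebU n). Qed.

(** Differentiating the recursion of [chebT] leaves one undifferentiated [chebT]; this identity
    removes it, so that the induction for the derivative closes on [chebU] alone. *)
Lemma chebT_U n : chebT n.+2 = 'X * chebU n.+1 - chebU n.
Proof.
elim/nat_ind2: n => [||n IH0 IH1]; [by rewrite /=; ring.. |].
by rewrite chebTSS IH1 IH0 !chebUSS; ring.
Qed.

Lemma deriv_chebT n : (chebT n.+1)^`() = n.+1%:R *: chebU n.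
Proof.
elim/nat_ind2: n => [||n IH0 IH1].
- by rewrite /= derivX scale1r.
- by rewrite /= derivB !derivM derivC derivX -polyC1 derivC -mul_polyC polyC1; ring.
rewrite chebTSS derivB !derivM derivC derivX IH0 IH1 chebT_U chebUSS -!mul_polyC.
by rewrite -(addn2 n.+1) natrD -(addn1 n.+1) natrD !polyCD; ring.
Qed.

End Chebyshev.

(** * Integration on segments, the weight [phi] and the arc cosine *)

Section IntegralsOnSegments.
Context {R : realType}.
Let mu := @lebesgue_measure R.
Implicit Types (a b x y t : R) (f F : R -> R).

Lemma continuous_integrable_segment f a b :
  {within `[a, b], continuous f} -> mu.-integrable `[a, b] (EFin \o f).
Proof. by move=> cf; apply: continuous_compact_integrable => //; exact: segment_compact. Qed.

Lemma FTC_within f F a b : a < b ->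
  {within `[a, b], continuous f} -> {within `[a, b], continuous F} ->
  {in `]a, b[, forall x, is_derive x 1 F (f x)} ->
  (\int[mu]_(x in `[a, b]) f x)%R = F b - F a.
Proof.
move=> ab cf cF dF; rewrite /Rintegral (@continuous_FTC2 _ f F)//.
- move/continuous_within_itvP: cF => /(_ ab)[_ ? ?]; split => // x /dF Fx.
  exact: ex_derive.
- by move=> x /dF Fx; rewrite derive1E derive_val.
Qed.

Lemma continuous_phi : continuous (@phi R).
Proof.
move=> x; apply: continuous_comp; last exact: sqrt_continuous.
by apply: cvgB; [exact: cvg_cst|exact: exprn_continuous].
Qed.

Lemma phi_ge0 x : 0 <= phi x.
Proof. exact: sqrtr_ge0. Qed.

Lemma phi_gt0 x : x \in `]-1, 1[ -> 0 < phi x.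
Proof.
rewrite in_itv/= => /andP[x1 x2]; rewrite sqrtr_gt0.
by rewrite -[X in X - _](expr1n _ 2) subr_sqr mulr_gt0//; lra.
Qed.

Lemma phi_cos t : 0 <= t <= pi -> phi (cos t) = sin t.
Proof.
by move=> /sin_ge0_pi t0; rewrite /phi -sin2cos2 sqrtr_sqr ger0_norm.
Qed.

Lemma within_continuous_acos : {within `[-1, 1], continuous (@acos R)}.
Proof.
have := @segment_can_ge_continuous R 0 pi cos acos; rewrite cospi cos0; apply.
- exact: pi_ge0.
- by apply: continuous_subspaceT => x; exact: continuous_cos.
- by move=> x; apply: cosK.
Qed.

Lemma sin_nat_pi (n : nat) : sin (n%:R * pi : R) = 0.
Proof.
elim: n => [|n IHn]; first by rewrite mul0r sin0.
by rewrite -natr1 mulrDl mul1r sinDpi IHn oppr0.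
Qed.

Lemma cos_nat_pi_sqr (n : nat) : cos (n%:R * pi : R) ^+ 2 = 1.
Proof. by rewrite cos2sin2 sin_nat_pi expr0n/= subr0. Qed.

End IntegralsOnSegments.

(** * The integral against [phi] and the orthogonality of the [chebU] *)

Section WeightedIntegral.
Context {R : realType}.
Let mu := @lebesgue_measure R.
Implicit Types (q r : {poly R}) (x t c : R).

Definition wint q : R := (\int[mu]_(x in `[(-1), 1]) (q.[x] * phi x))%R.

Lemma integrable_wint q :
  mu.-integrable `[(-1), 1] (EFin \o (fun x => q.[x] * phi x)).
Proof.
apply: continuous_integrable_segment; apply: continuous_subspaceT => x.
by apply: cvgM; [exact: continuous_horner|exact: continuous_phi].
Qed.

Lemma wint_scalar : scalar wint.
Proof.
move=> c q r; rewrite /wint.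
rewrite -RintegralZl//; last exact: integrable_wint.
rewrite -RintegralD//; last 2 first.
- exact: integrableZl (integrable_wint q).
- exact: integrable_wint.
by apply: eq_Rintegral => x _; rewrite hornerD hornerZ; ring.
Qed.

HB.instance Definition _ :=
  GRing.isLinear.Build R {poly R} R *%R wint wint_scalar.

(** An antiderivative of [cos (c * t)] that also covers [c = 0], so that the cases [i = j] and
    [i != j] of orthogonality share one computation. *)
Let S c t : R := if c == 0 then t else sin (c * t) / c.

Let is_derive_S c t : is_derive t 1 (S c) (cos (c * t)).
Proof.
rewrite /S; case: eqP => [->|/eqP c0].
  by rewrite mul0r cos0; exact: is_derive_id.
apply: is_derive_eq.
rewrite /GRing.scale/= !mulr1; field => //.
Qed.

(** The substitution [x = cos t] is carried out on the antiderivative: the integrand is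
    [sin (A t) sin (B t) / phi x] at [t = acos x], and [acos] has derivative [- 1 / phi], so
    [- G (acos x)] is a primitive. *)
Lemma wint_chebU i j :
  wint (chebU i * chebU j) = if i == j then pi / 2 else 0.
Proof.
pose A : R := i.+1%:R; pose B : R := j.+1%:R.
pose G t := 2^-1 * (S (A - B) t - S (A + B) t).
have dG t : is_derive t 1 G (sin (A * t) * sin (B * t)).
  have -> : sin (A * t) * sin (B * t) =
            2^-1 * (cos ((A - B) * t) - cos ((A + B) * t)).
    by rewrite mulrBl mulrDl cosB cosD; field.
  have d1 := is_derive_S (A - B) t; have d2 := is_derive_S (A + B) t.
  by rewrite /G; apply: is_derive_eq.
have cG : continuous G.
  by move=> t; apply: differentiable_continuous; apply/derivable1_diffP; apply: ex_derive.
rewrite /wint (@FTC_within _ _ (fun x => - G (acos x)))//; first last.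
- move=> x; rewrite in_itv/= => xI.
  have xI' : -1 <= x <= 1 by case/andP: xI => ? ?; rewrite !ltW.
  have ph0 : 0 < phi x by apply: phi_gt0; rewrite in_itv.
  have := is_derive1_acos xI; rewrite -/(phi x) => dac.
  apply: is_derive_eq.
  rewrite -!chebU_cos hornerM acosK ?in_itv//= sin_acos// -/(phi x).
  by rewrite /GRing.scale/= ; field; rewrite gt_eqF.
- move=> x; apply: cvgN; apply: continuous_comp; [exact: within_continuous_acos|exact: cG].
- apply: continuous_subspaceT => x.
  by apply: cvgM; [exact: continuous_horner|exact: continuous_phi].
rewrite acosN1 acos1 opprK /G /S.
have AB0 : (A + B == 0) = false by rewrite gt_eqF// addr_gt0// ltr0n.
rewrite AB0 !mulr0 sin0 mul0r.
have sABpi : sin ((A + B) * pi) = 0 by rewrite mulrDl sinD !sin_nat_pi mul0r mulr0 addr0.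
have sApi : sin ((A - B) * pi) = 0 by rewrite mulrBl sinB !sin_nat_pi mul0r mulr0 subr0.
rewrite sABpi subr_eq0 eqr_nat eqSS; case: eqP => [_|_].
  by rewrite mul0r; field.
by rewrite sApi !mul0r; ring.
Qed.

End WeightedIntegral.

(** * Orthonormal expansions and the identification of [p] *)

Section OrthonormalPolynomials.
Context {R : realType}.
Implicit Types (q : {poly R}).

Lemma poly_basis (p : nat -> {poly R}) (hp : forall j, size (p j) = j.+1) n q :
  (size q <= n)%N -> exists c : nat -> R, q = \sum_(j < n) c j *: p j.
Proof.
elim: n q => [|n IHn] q.
  by rewrite leqn0 size_poly_eq0 => /eqP ->; exists (fun=> 0); rewrite big_ord0.
move=> sq; pose a := q`_n / lead_coef (p n).
have pn0 : lead_coef (p n) != 0 by rewrite lead_coef_eq0 -size_poly_gt0 hp.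
have : (size (q - a *: p n)%R <= n)%N.
  apply/leq_sizeP => i; rewrite leq_eqVlt => /predU1P[<-|ni].
    rewrite coefB coefZ /a (_ : (p n)`_n = lead_coef (p n)); last by rewrite lead_coefE hp.
    by rewrite divfK// subrr.
  rewrite coefB coefZ !nth_default ?mulr0 ?subr0 ?hp//.
  exact: leq_trans sq _.
move=> /IHn[c qc]; exists (fun i => if i == n then a else c i).
rewrite big_ord_recr/= eqxx; apply/eqP; rewrite -subr_eq; apply/eqP.
rewrite qc; apply: eq_bigr => i _; rewrite ifN_eq//.
by rewrite neq_ltn ltn_ord.
Qed.

Variables (p : nat -> {poly R}) (hp : orthonormal_phi p).

Lemma wint_orthonormal i j : wint (p i * p j) = (i == j)%:R.
Proof.
case: hp => _ _ <-; rewrite /wint; apply: eq_Rintegral => t _.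
by rewrite hornerM.
Qed.

Lemma wint_orthogonal m q : (size q <= m)%N -> wint (q * p m) = 0.
Proof.
case: (hp) => sp _ _ /(poly_basis sp)[c ->].
rewrite mulr_suml linear_sum big1// => i _.
by rewrite -scalerAl linearZ/= wint_orthonormal ltn_eqF// mulr0.
Qed.

Lemma orthonormal_expansion n q :
  (size q <= n)%N -> q = \sum_(j < n) wint (q * p j) *: p j.
Proof.
case: (hp) => sp _ _ /(poly_basis sp)[c qc].
rewrite {1}qc; apply: eq_bigr => i _; congr (_ *: _).
rewrite qc mulr_suml linear_sum (bigD1 i)//= -scalerAl linearZ/=.
rewrite wint_orthonormal eqxx [X in _ = X + _]mulr1 big1 ?addr0// => j ji.
rewrite -scalerAl linearZ/= wint_orthonormal.
by rewrite (negbTE (ji : j != i :> nat)) mulr0.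
Qed.

(** [chebU j] is orthogonal to every polynomial of lower degree, so its expansion in the [p i] has
    only the term [c *: p j]. Its squared norm [pi / 2] gives [c ^+ 2], and the positive leading
    coefficients fix the sign of [c]. *)
Lemma orthonormal_chebU j : p j = Num.sqrt (2 / pi) *: chebU j.
Proof.
case: (hp) => sp lp _.
have pi0 := @pi_gt0 R.
have UpE : chebU j = wint (chebU j * p j) *: p j.
  have sU : (size (@chebU R j) <= j.+1)%N by rewrite size_chebU.
  rewrite {1}(orthonormal_expansion sU) big_ord_recr/= big1 ?add0r// => i _.
  suff -> : wint (chebU j * p i) = 0 by rewrite scale0r.
  have [|c ->] := @poly_basis (@chebU R) size_chebU i.+1 (p i); first by rewrite sp.
  rewrite mulr_sumr linear_sum/= big1// => l _.
  rewrite -scalerAr linearZ/= wint_chebU gtn_eqF ?mulr0//.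
  exact: leq_ltn_trans (leq_ord l) (ltn_ord i).
set c := wint _ in UpE.
have cc : c ^+ 2 = pi / 2.
  have := @wint_chebU R j j; rewrite eqxx => <-.
  by rewrite UpE -scalerAl -scalerAr !linearZ/= wint_orthonormal eqxx mulr1 expr2.
have c0 : 0 < c.
  have := @lead_coef_chebU R j; rewrite UpE lead_coefZ => cl.
  have : 0 < c * lead_coef (p j) by rewrite cl exprn_gt0.
  by rewrite pmulr_lgt0.
have -> : Num.sqrt (2 / pi) = c^-1.
  have -> : 2 / pi = (c^-1) ^+ 2 by rewrite exprVn cc invf_div.
  by rewrite sqrtr_sqr ger0_norm// invr_ge0 ltW.
by rewrite UpE scalerA mulVf ?scale1r// gt_eqF.
Qed.

Lemma orthonormal_cos j t :
  (p j).[cos t] * sin t = Num.sqrt (2 / pi) * sin (j.+1%:R * t).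
Proof. by rewrite orthonormal_chebU hornerZ -mulrA chebU_cos. Qed.

End OrthonormalPolynomials.

(** * Lagrange interpolation and Gauss quadrature at the zeros of [p m] *)

Section GaussQuadrature.
Context {R : realType}.
Variables (m : nat) (x : 'I_m -> R) (x_inj : injective x).
Implicit Types (q r : {poly R}) (k l : 'I_m).

Lemma lagr_node k l : (lagr x k).[x l] = (k == l)%:R.
Proof.
rewrite /lagr horner_prod; have [<-|kl] := eqVneq k l.
  rewrite big1// => j jk; rewrite hornerZ hornerXsubC mulVf// subr_eq0.
  by apply: contra_neq jk => /x_inj ->.
rewrite (bigD1 l)/=; last by rewrite eq_sym.
by rewrite hornerZ hornerXsubC subrr mulr0 mul0r.
Qed.

Lemma size_lagr k : (size (lagr x k) <= m)%N.
Proof.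
have := size_prod_leq [pred j | j != k] (fun j => (x k - x j)^-1 *: ('X - (x j)%:P)).
move=> /leq_trans; apply.
have : (\sum_(j | j != k) size ((x k - x j)^-1 *: ('X - (x j)%:P))%R <= \sum_(j < m | j != k) 2)%N.
  by apply: leq_sum => j _; rewrite (leq_trans (size_scale_leq _ _))// size_XsubC.
have := ltn_ord k; rewrite sum_nat_const cardC1 card_ord /=.
set s := (\sum_(_ | _) _)%N; lia.
Qed.

Lemma size_interp (G : R -> R) : (size (interp x G) <= m)%N.
Proof.
apply: (leq_trans (size_sum _ _ _)); apply/bigmax_leqP => k _.
exact: leq_trans (size_scale_leq _ _) (size_lagr k).
Qed.

Lemma interp_node (G : R -> R) l : (interp x G).[x l] = G (x l).
Proof.
rewrite /interp horner_sum (bigD1 l)//= hornerZ lagr_node eqxx mulr1.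
rewrite big1 ?addr0// => k kl.
by rewrite hornerZ lagr_node (negbTE kl) mulr0.
Qed.

Lemma poly_eq_nodes q r : (size q <= m)%N -> (size r <= m)%N ->
  (forall l, q.[x l] = r.[x l]) -> q = r.
Proof.
move=> sq sr qr; apply/eqP; rewrite -subr_eq0; apply/negPn/negP => nz.
have : (size (codom x) < size (q - r)%R)%N.
  apply: max_poly_roots => //; last by rewrite map_inj_uniq ?enum_uniq.
  by apply/allP => _ /codomP[l ->]; rewrite rootE !hornerE qr subrr.
rewrite size_codom card_ord ltnNge => /negP; apply.
by rewrite (leq_trans (size_polyD _ _))// geq_max sq size_polyN.
Qed.

Lemma interp_poly q : (size q <= m)%N -> interp x (horner q) = q.
Proof.
by move=> sq; apply: poly_eq_nodes => [|//|l]; [exact: size_interp|exact: interp_node].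
Qed.

Lemma christoffelE k : christoffel x k = wint (lagr x k).
Proof. by []. Qed.

Variables (p : nat -> {poly R}) (hp : orthonormal_phi p).
Hypothesis px0 : forall l, root (p m) (x l).

(** Divide by [p m]: the quotient has degree below m and is orthogonal to [p m], while the remainder
    equals its own interpolant and agrees with [q] at the nodes. The size bound means degree at most
    2m - 1. *)
Lemma gauss_quadrature q : (size q <= m.*2)%N ->
  wint q = \sum_(l < m) christoffel x l * q.[x l].
Proof.
move=> sq; case: (hp) => sp _ _.
have pm0 : p m != 0 by rewrite -size_poly_gt0 sp.
rewrite [in LHS](divp_eq q (p m)) linearD/=.
rewrite (wint_orthogonal hp) ?add0r; last first.
  by rewrite size_divp// sp/= leq_subLR addnn.
have sr : (size (q %% p m)%R <= m)%N by rewrite -ltnS -(sp m) ltn_modp.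
rewrite -{1}(interp_poly sr) /interp linear_sum; apply: eq_bigr => l _.
rewrite linearZ/= christoffelE [RHS]mulrC; congr (_ * _).
by rewrite [in RHS](divp_eq q (p m)) hornerD hornerM (rootP (px0 l)) mulr0 add0r.
Qed.

(** The coefficients [wint (lagr x l * p j)] are computed exactly by quadrature, where only node [l]
    survives. Interpolation thereby becomes summation against a kernel in the [p j], which is a sine
    kernel in the angles. *)
Lemma lagr_expansion l :
  lagr x l = christoffel x l *: \sum_(j < m) (p j).[x l] *: p j.
Proof.
case: (hp) => sp _ _.
rewrite {1}(orthonormal_expansion hp (size_lagr l)) scaler_sumr.
apply: eq_bigr => j _; rewrite scalerA; congr (_ *: _).
rewrite gauss_quadrature; last first.
  rewrite (leq_trans (size_polyMleq _ _))// sp addnS/= -addnn leq_add//.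
    exact: size_lagr.
  exact: ltnW.
rewrite (bigD1 l)//= hornerM lagr_node eqxx mul1r big1 ?addr0// => k kl.
by rewrite hornerM lagr_node eq_sym (negbTE kl) mul0r mulr0.
Qed.

Lemma christoffel_inv l :
  christoffel x l * (\sum_(j < m) (p j).[x l] ^+ 2) = 1.
Proof.
have := lagr_node l l; rewrite eqxx lagr_expansion hornerZ horner_sum => E; rewrite -[RHS]E.
by congr (_ * _); apply: eq_bigr => j _; rewrite hornerZ expr2.
Qed.

End GaussQuadrature.

(** * Principal value integrals of polynomials times [phi] *)

Section PrincipalValue.
Context {R : realType}.
Let mu := @lebesgue_measure R.
Implicit Types (e x y c : R) (f : R -> R) (q r Q : {poly R}).

Let E e y : set R := [set x | x \in `[(-1), 1] /\ e < `|x - y|].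

Let E_itv e y : 0 < e -> -1 < y - e -> y + e < 1 ->
  E e y = `[-1, y - e[ `|` `]y + e, 1].
Proof.
move=> e0 ye1 ye2; apply/seteqP; split => x; rewrite /E /= !in_itv/=.
  by move=> [/andP[x1 x2]]; rewrite ltr_normr => /orP[exy|exy]; [right|left];
  apply/andP; split; lra.
move=> [/andP[x1 x2]|/andP[x1 x2]]; (split; first by apply/andP; split; lra);
  rewrite ltr_normr; apply/orP; [right|left]; lra.
Qed.

Let measurable_E e y : measurable (E e y).
Proof.
rewrite (_ : E e y = `[(-1), 1] `&` (`]-oo, y - e[ `|` `]y + e, +oo[)); last first.
  apply/seteqP; split => x; rewrite /E /= !in_itv/= ?andbT.
    by move=> [-> ]; rewrite ltr_normr => /orP[exy|exy]; split => //; [right|left]; lra.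
  by move=> [-> [h|h]]; split => //; rewrite ltr_normr; apply/orP; [right|left]; lra.
by apply: measurableI => //; apply: measurableU.
Qed.

Let integrable_E f e y : {within `[(-1), 1], continuous f} ->
  mu.-integrable (E e y) (EFin \o f).
Proof.
move=> cf; apply: integrableS (continuous_integrable_segment cf) => //.
  exact: measurable_E.
by move=> x [].
Qed.

Let integral_E f e y : 0 < e -> -1 < y - e -> y + e < 1 ->
  {within `[(-1), 1], continuous f} ->
  (\int[mu]_(x in E e y) f x)%R =
  (\int[mu]_(x in `[(-1)%R, y - e]) f x)%R + (\int[mu]_(x in `[y + e, 1%R]) f x)%R.
Proof.
move=> e0 ye1 ye2 cf.
have iE := integrable_E e y cf.
have i1 := continuous_integrable_segment cf.
rewrite E_itv// in iE *; rewrite Rintegral_setU//; last first.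
  apply/disj_setPS => x /= [] /=; rewrite !in_itv/= => /andP[? ?] /andP[? ?]; lra.
rewrite Rintegral_itv_bndo_bndc; last first.
  apply: integrableS i1 => // x; rewrite /= !in_itv/= => /andP[-> ?]; lra.
rewrite Rintegral_itv_obnd_cbnd//.
apply: integrableS i1 => // x; rewrite /= !in_itv/= => /andP[? ->]; rewrite andbT; lra.
Qed.

(* A continuous function that is [1 / (x - y)] for [e <= |x - y|], as the
   maximum of [e ^ 2] and [(x - y) ^ 2] is then the latter. *)
Let inv_cut e y x : R :=
  2 * (x - y) / (e ^+ 2 + (x - y) ^+ 2 + `|(x - y) ^+ 2 - e ^+ 2|).

Let continuous_inv_cut e y : 0 < e -> continuous (inv_cut e y).
Proof.
move=> e0 x; have cxy : x - y @[x --> x] --> x - y.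
  by apply: cvgB; [exact: cvg_id|exact: cvg_cst].
apply: cvgM; first by apply: cvgM => //; exact: cvg_cst.
apply: cvgV.
  by rewrite gt_eqF// -addrA ltr_wpDr ?exprn_gt0// addr_ge0// sqr_ge0.
have csqr : (x - y) ^+ 2 @[x --> x] --> (x - y) ^+ 2 by rewrite expr2; exact: cvgM.
apply: cvgD; first by apply: cvgD => //; exact: cvg_cst.
by apply: cvg_norm; apply: cvgB => //; exact: cvg_cst.
Qed.

Let inv_cutE e y x : 0 < e -> e <= `|x - y| -> inv_cut e y x = (x - y)^-1.
Proof.
move=> e0 exy; have xy0 : x - y != 0 by rewrite -normr_gt0; exact: lt_le_trans exy.
have exy2 : e ^+ 2 <= (x - y) ^+ 2.
  by rewrite -[leRHS]real_normK ?num_real// ler_pXn2r// nnegrE ltW.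
rewrite /inv_cut ger0_norm ?subr_ge0//.
have -> : e ^+ 2 + (x - y) ^+ 2 + ((x - y) ^+ 2 - e ^+ 2) = 2 * (x - y) ^+ 2 by ring.
by field.
Qed.

Definition pv_trunc q y e : R := (\int[mu]_(x in E e y) (q.[x] * phi x / (x - y)))%R.

Let cut q y e x := q.[x] * phi x * inv_cut e y x.

Let continuous_cut q y e : 0 < e -> continuous (cut q y e).
Proof.
move=> e0 x; apply: cvgM; last exact: continuous_inv_cut.
by apply: cvgM; [exact: continuous_horner|exact: continuous_phi].
Qed.

Let pv_truncE q y e : 0 < e -> pv_trunc q y e = (\int[mu]_(x in E e y) cut q y e x)%R.
Proof.
move=> e0; apply: eq_Rintegral => x; rewrite inE => -[_ exy].
by rewrite /cut inv_cutE// ltW.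
Qed.

Let pv_trunc_linear c q r y e : 0 < e ->
  pv_trunc (c *: q + r) y e = c * pv_trunc q y e + pv_trunc r y e.
Proof.
move=> e0; have mE := measurable_E e y; rewrite !pv_truncE//.
have ci s : mu.-integrable (E e y) (EFin \o cut s y e).
  by apply: integrable_E; apply: continuous_subspaceT; exact: continuous_cut.
rewrite -RintegralZl// -RintegralD//; last exact: integrableZl (ci q).
by apply: eq_Rintegral => x _; rewrite /cut hornerD hornerZ; ring.
Qed.

(** From [x / (x - y) = 1 + y / (x - y)]. This is what lets the three-term recursion pass through
    the principal value. *)
Let pv_trunc_mulX q y e : 0 < e ->
  pv_trunc ('X * q) y e = y * pv_trunc q y e + (\int[mu]_(x in E e y) (q.[x] * phi x))%R.
Proof.
move=> e0; have mE := measurable_E e y; rewrite (pv_truncE q)//.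
have ci s : mu.-integrable (E e y) (EFin \o cut s y e).
  by apply: integrable_E; apply: continuous_subspaceT; exact: continuous_cut.
have i2 : mu.-integrable (E e y) (EFin \o (fun x => q.[x] * phi x)).
  apply: integrable_E; apply: continuous_subspaceT => x.
  by apply: cvgM; [exact: continuous_horner|exact: continuous_phi].
rewrite -RintegralZl// -(RintegralD _ _ i2)//; last exact: integrableZl (ci q).
apply: eq_Rintegral => x; rewrite inE => -[_ exy].
have xy0 : x - y != 0 by rewrite -normr_gt0 (lt_trans e0).
by rewrite /cut inv_cutE ?(ltW exy)// hornerM hornerX; field.
Qed.

Lemma symmetric_difference_cvg f y : {for y, continuous f} ->
  f (y - e) - f (y + e) @[e --> 0^'+] --> (0 : R).
Proof.
move=> cf; rewrite -[X in _ --> X](subrr (f y)).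
have id0 : (e : R) @[e --> (0 : R)^'+] --> (0 : R) by apply: cvg_at_right_filter; exact: cvg_id.
apply: cvgB; (apply: continuous_cvg; first exact: cf).
  by rewrite -[X in _ --> X](subr0 y); apply: cvgB id0; exact: cvg_cst.
by rewrite -[X in _ --> X](addr0 y); apply: cvgD id0; exact: cvg_cst.
Qed.

Lemma pv_trunc_split q y e : 0 < e -> -1 < y - e -> y + e < 1 ->
  pv_trunc q y e =
  (\int[mu]_(x in `[(-1)%R, (y - e)%R]) (q.[x] * phi x / (x - y)))%R +
  (\int[mu]_(x in `[(y + e)%R, 1%R]) (q.[x] * phi x / (x - y)))%R.
Proof.
move=> e0 ye1 ye2; rewrite pv_truncE// integral_E//; last first.
  by apply: continuous_subspaceT; exact: continuous_cut.
by congr (_ + _); apply: eq_Rintegral => x; rewrite inE/= in_itv/= => /andP[? ?];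
  rewrite /cut inv_cutE// ler_normr; apply/orP; [right|left]; lra.
Qed.

Let integral_E_cvg f y : y \in `]-1, 1[ -> continuous f ->
  (\int[mu]_(x in E e y) f x)%R @[e --> 0^'+] --> (\int[mu]_(x in `[(-1), 1]) f x)%R.
Proof.
rewrite in_itv/= => /andP[y1 y2] cf.
have cfW : {within `[(-1), 1], continuous f} by exact: continuous_subspaceT.
have intf := continuous_integrable_segment cfW.
(* With the primitive [P], the removed interval costs [P (y + e) - P (y - e)], which vanishes in the
   limit by continuity. *)
pose P z := (\int[mu]_(x in `[(-1)%R, z]) f x)%R.
have cP : {for y, continuous P}.
  apply: (@within_continuous_continuous _ _ _ (-1) 1) => //.
  - exact: parameterized_integral_continuous.
  - by rewrite in_itv/= y1.
have -> : (\int[mu]_(x in `[(-1), 1]) f x)%R = 0 + P 1 by rewrite add0r.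
apply: cvg_trans (cvgD (symmetric_difference_cvg cP) (cvg_cst (P 1))).
apply: near_eq_cvg; near=> e.
have e0 : 0 < e by near: e; exact: nbhs_right_gt.
have ey1 : e < 1 + y by near: e; apply: nbhs_right_lt; lra.
have ey2 : e < 1 - y by near: e; apply: nbhs_right_lt; lra.
have -> : (\int[mu]_(x in E e y) f x)%R =
    (\int[mu]_(x in `[(-1)%R, y - e]) f x)%R + (P 1 - P (y + e)).
  rewrite integral_E//; [|lra..]; congr (_ + _).
  rewrite /P (@Rintegral_itvB _ f (BLeft (-1)) (BRight 1) (y + e))// ?bnd_simp; [|lra..].
  rewrite Rintegral_itv_obnd_cbnd//.
  apply: (integrableS _ _ _ intf) => // x; rewrite /= !in_itv/= => /andP[? ->]; rewrite andbT; lra.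
by rewrite -/(P _); transitivity (P (y - e) - P (y + e) + P 1); [by []|ring].
Unshelve. all: by end_near. Qed.

(** The finite Hilbert transform of [q phi], up to the factor [- pi^-1], is the polynomial [Q]. It
    is stated as convergence, because a bare [lim] says nothing when the limit fails to exist. *)
Definition pv_lim q Q := forall y, y \in `]-1, 1[ ->
  pv_trunc q y e @[e --> 0^'+] --> Q.[y].

Lemma pv_lim_linear c q r Q1 Q2 : pv_lim q Q1 -> pv_lim r Q2 ->
  pv_lim (c *: q + r) (c *: Q1 + Q2).
Proof.
move=> h1 h2 y yI; rewrite hornerD hornerZ.
have H : c * pv_trunc q y e + pv_trunc r y e @[e --> 0^'+] --> c * Q1.[y] + Q2.[y].
  by apply: cvgD; [apply: cvgM; [exact: cvg_cst|exact: h1]|exact: h2].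
apply: cvg_trans H; apply: near_eq_cvg; near=> e.
by rewrite pv_trunc_linear//; near: e; exact: nbhs_right_gt.
Unshelve. all: by end_near. Qed.

Lemma pv_lim_mulX q Q : pv_lim q Q -> pv_lim ('X * q) ('X * Q + (wint q)%:P).
Proof.
move=> h y yI; rewrite hornerD hornerM hornerX hornerC.
have cq : continuous (fun x => q.[x] * phi x).
  by move=> x; apply: cvgM; [exact: continuous_horner|exact: continuous_phi].
have H : y * pv_trunc q y e + (\int[mu]_(x in E e y) (q.[x] * phi x))%R
    @[e --> 0^'+] --> y * Q.[y] + wint q.
  by apply: cvgD; [apply: cvgM; [exact: cvg_cst|exact: h]|exact: integral_E_cvg].
apply: cvg_trans H; apply: near_eq_cvg; near=> e.
by rewrite pv_trunc_mulX//; near: e; exact: nbhs_right_gt.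
Unshelve. all: by end_near. Qed.

End PrincipalValue.

(** * The principal value for [phi] and for [chebU n] times [phi] *)

Section HilbertTransformOfPhi.
Context {R : realType}.
Let mu := @lebesgue_measure R.
Implicit Types (e x y c : R).

Lemma is_derive_phi x : x \in `]-1, 1[ -> is_derive x 1 (@phi R) (- x / phi x).
Proof.
move=> xI; have := phi_gt0 xI; rewrite {1}/phi sqrtr_gt0 => x0.
have p0 := phi_gt0 xI.
have d1 : is_derive x 1 (fun z : R => 1 - z ^+ 2) (- (2 * x)).
  by apply: is_derive_eq; rewrite /GRing.scale/=; ring.
have d2 := is_derive1_sqrt x0.
have H := @is_derive1_comp R Num.sqrt (fun z => 1 - z ^+ 2) x _ _ d2 d1.
apply: (@is_derive_eq _ _ _ _ _ _ _ _ H).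
by rewrite -/(phi x); field; rewrite gt_eqF.
Qed.

Section Antiderivative.
Variables (y : R) (yI : y \in `]-1, 1[).

(* [G] is an antiderivative of [phi x / (x - y)] on both sides of [y]. Only its
   last term is singular at [y], with equal values at [y - e] and [y + e]. *)
Let D x := 1 - x * y + phi x * phi y.
Let L x := phi x + y * acos x - phi y * ln (D x).
Let G x := L x + phi y * (ln ((x - y) ^+ 2) / 2).

(** For [x = cos s] and [y = cos t], [D x] is [1 - cos (s + t) = 2 sin^2 ((s + t) / 2)], and [s + t]
    stays strictly between 0 and 2 pi as [y] is interior. The two logarithms of [G] together form
    [ln (|sin ((s - t) / 2)| / sin ((s + t) / 2))]. *)
Let D_gt0 x : x \in `[(-1), 1] -> 0 < D x.
Proof.
move: yI; rewrite !in_itv/= => /andP[y1 y2] /andP[x1 x2].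
rewrite ltr_pwDl ?mulr_ge0 ?phi_ge0//.
have [y0|y0] := lerP 0 y; nra.
Qed.

Let continuous_D : continuous D.
Proof.
move=> x; apply: cvgD; last first.
  by apply: cvgM; [exact: continuous_phi|exact: cvg_cst].
apply: cvgB; first exact: cvg_cst.
by apply: cvgM; [exact: cvg_id|exact: cvg_cst].
Qed.

Let continuous_L : {within `[(-1), 1], continuous L}.
Proof.
have lnD : {within `[(-1), 1], continuous (@ln R \o D)}.
  apply: continuous_in_subspaceT => z; rewrite inE /= => zI.
  apply: continuous_comp; first exact: continuous_D.
  by apply: continuous_ln; exact: D_gt0.
have phW : {within `[(-1), 1], continuous (@phi R)}.
  by apply: continuous_subspaceT; exact: continuous_phi.
move=> x; apply: cvgB; last by apply: cvgM; [exact: cvg_cst|exact: lnD].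
apply: cvgD; first exact: phW.
by apply: cvgM; [exact: cvg_cst|exact: within_continuous_acos].
Qed.

Let is_derive_G x : x \in `]-1, 1[ -> x != y -> is_derive x 1 G (phi x / (x - y)).
Proof.
move=> xI xy; have dphi := is_derive_phi xI.
have px := phi_gt0 xI; have py := phi_gt0 yI.
have dac := @is_derive1_acos R x; move: dac; rewrite -/(phi x).
move: (xI); rewrite in_itv/= => xI' /(_ xI') dac.
have D0 : 0 < D x by apply: D_gt0; move: xI'; rewrite in_itv/= => /andP[? ?]; rewrite !ltW.
have dD : is_derive x 1 D (- y - x / phi x * phi y).
  by apply: is_derive_eq; rewrite /GRing.scale/=; ring.
have dlnD := @is_derive1_comp R (@ln R) D x _ _ (is_derive1_ln D0) dD.
have xy2 : 0 < (x - y) ^+ 2 by rewrite exprn_even_gt0//= subr_eq0.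
have dq : is_derive x 1 (fun z : R => (z - y) ^+ 2) (2 * (x - y)).
  by apply: is_derive_eq; rewrite /GRing.scale/=; ring.
have dlnq := @is_derive1_comp R (@ln R) (fun z => (z - y) ^+ 2) x _ _ (is_derive1_ln xy2) dq.
have phi2 : phi x ^+ 2 = 1 - x ^+ 2.
  rewrite sqr_sqrtr//; move: xI'; move/andP => [? ?].
  by rewrite -[X in X - _](expr1n _ 2) subr_sqr mulr_ge0//; lra.
have phiy2 : phi y ^+ 2 = 1 - y ^+ 2.
  rewrite sqr_sqrtr//; move: yI; rewrite in_itv/= => /andP [? ?].
  by rewrite -[X in X - _](expr1n _ 2) subr_sqr mulr_ge0//; lra.
apply: is_derive_eq.
rewrite /GRing.scale/=.
have xy0 : x - y != 0 by rewrite subr_eq0.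
have px0 : phi x != 0 by rewrite gt_eqF.
(* The logarithmic derivative of [D]. Since [field] does not know that [phi x ^+ 2 = 1 - x ^+ 2],
   the difference of the two sides is displayed as a combination of this relation at [x] and at
   [y]. *)
have -> : - y - x / phi x * phi y = D x * ((1 - phi y / phi x) / (x - y)).
  apply/eqP; rewrite -subr_eq0; apply/eqP.
  transitivity ((phi x * (phi y ^+ 2 - (1 - y ^+ 2)) -
    phi y * (phi x ^+ 2 - (1 - x ^+ 2))) / (phi x * (x - y))).
    by rewrite /D; field; apply/andP.
  by rewrite phi2 phiy2 !subrr !mulr0 subrr mul0r.
rewrite mulKf ?gt_eqF//; apply/eqP; rewrite -subr_eq0; apply/eqP.
transitivity (((phi y ^+ 2 - (1 - y ^+ 2)) - (phi x ^+ 2 - (1 - x ^+ 2))) /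
    (phi x * (x - y))).
  by field; apply/andP.
by rewrite phi2 phiy2 !subrr mul0r.
Qed.

Let sqr_neq0_ln_continuous x : x != y ->
  {for x, continuous (fun z => phi y * (ln ((z - y) ^+ 2) / 2))}.
Proof.
move=> xy; have csub : z - y @[z --> x] --> x - y.
  by apply: cvgB; [exact: cvg_id|exact: cvg_cst].
apply: cvgM; first exact: cvg_cst.
apply: cvgM; last exact: cvg_cst.
apply: continuous_cvg; last by rewrite expr2; exact: cvgM.
by apply: continuous_ln; rewrite exprn_even_gt0//= subr_eq0.
Qed.

Let integral_phi_div a b : -1 <= a -> b <= 1 -> a < b -> y \notin `[a, b] ->
  (\int[mu]_(x in `[a, b]) (phi x / (x - y)))%R = G b - G a.
Proof.
move=> a1 b1 ab yab.
have neq x : x \in `[a, b] -> x != y by move=> xab; apply: contraNneq yab => <-.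
apply: FTC_within => //.
- apply: continuous_in_subspaceT => x; rewrite inE /= => xab.
  apply: cvgM; first exact: continuous_phi.
  apply: cvgV; first by rewrite subr_eq0 neq.
  by apply: cvgB; [exact: cvg_id|exact: cvg_cst].
- have cL : {within `[a, b], continuous L}.
    apply: continuous_subspaceW continuous_L => x; rewrite /= !in_itv/= => /andP[? ?].
    by apply/andP; split; lra.
  have cl : {within `[a, b], continuous (fun z => phi y * (ln ((z - y) ^+ 2) / 2))}.
    apply: continuous_in_subspaceT => x; rewrite inE /= => xab.
    exact/sqr_neq0_ln_continuous/neq.
  by move=> x; apply: cvgD; [exact: cL|exact: cl].
- move=> x xab; apply: is_derive_G; last first.
    by apply: neq; move: xab; rewrite !in_itv/= => /andP[? ?]; rewrite !ltW.
  by move: xab; rewrite !in_itv/= => /andP[? ?]; apply/andP; split; lra.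
Qed.

(** At an endpoint [phi] vanishes and [D x = |x - y|], so the logarithms cancel and only
    [y * acos x] remains. *)
Let G_N1 : G (-1) = pi * y.
Proof.
move: yI; rewrite in_itv/= => /andP[y1 y2].
rewrite /G /L /D (_ : phi (-1) = 0); last by rewrite /phi sqrrN expr1n subrr sqrtr0.
rewrite mul0r add0r addr0 acosN1 -opprD sqrrN mulN1r opprK lnXn; last by lra.
by rewrite -mulr_natr; field.
Qed.

Let G_1 : G 1 = 0.
Proof.
move: yI; rewrite in_itv/= => /andP[y1 y2].
rewrite /G /L /D (_ : phi 1 = 0); last by rewrite /phi expr1n subrr sqrtr0.
rewrite mul0r add0r addr0 acos1 mulr0 mul1r lnXn; last by lra.
by rewrite -mulr_natr; field.
Qed.

Let pv_trunc_1 e : 0 < e -> -1 < y - e -> y + e < 1 ->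
  pv_trunc 1 y e = L (y - e) - L (y + e) - pi * y.
Proof.
move=> e0 ye1 ye2; rewrite pv_trunc_split//.
under eq_Rintegral do rewrite hornerC mul1r.
under [X in _ + X = _]eq_Rintegral do rewrite hornerC mul1r.
rewrite integral_phi_div; [|lra..|by apply/negP; rewrite in_itv/= => /andP[? ?]; lra].
rewrite integral_phi_div; [|lra..|by apply/negP; rewrite in_itv/= => /andP[? ?]; lra].
rewrite G_N1 G_1 /G.
have -> : (y - e - y) ^+ 2 = (y + e - y) ^+ 2 by ring.
ring.
Qed.

Lemma pv_trunc_1_cvg : pv_trunc 1 y e @[e --> 0^'+] --> - (pi * y).
Proof.
move: (yI); rewrite in_itv/= => /andP[y1 y2].
have cL : {for y, continuous L}.
  exact: (@within_continuous_continuous _ _ _ (-1) 1).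
have H : L (y - e) - L (y + e) - pi * y @[e --> 0^'+] --> 0 - pi * y.
  by apply: cvgB; [exact: symmetric_difference_cvg|exact: cvg_cst].
rewrite sub0r in H; apply: cvg_trans H; apply: near_eq_cvg; near=> e.
have e0 : 0 < e by near: e; exact: nbhs_right_gt.
have ey1 : e < 1 + y by near: e; apply: nbhs_right_lt; lra.
have ey2 : e < 1 - y by near: e; apply: nbhs_right_lt; lra.
by rewrite pv_trunc_1//; lra.
Unshelve. all: by end_near. Qed.

End Antiderivative.

Lemma pv_lim_1 : pv_lim 1 (- pi *: 'X : {poly R}).
Proof. by move=> y yI; rewrite hornerZ hornerX mulNr; exact: pv_trunc_1_cvg. Qed.

Lemma pv_lim0 : pv_lim (0 : {poly R}) 0.
Proof.
have := pv_lim_linear (c := -1) pv_lim_1 pv_lim_1.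
by rewrite !scaleN1r !addNr.
Qed.

(** [chebU] and [chebT] obey the same recursion, and multiplication by 'X adds only
    [wint (chebU n)]. This constant is zero except for [n = 0], where it is [pi / 2] and supplies
    the -1 of [2 X^2 - 1]. *)
Lemma pv_lim_chebU n : pv_lim (chebU n : {poly R}) (- pi *: chebT n.+1).
Proof.
have W0 j : wint (chebU j.+1 : {poly R}) = 0.
  by have := @wint_chebU R j.+1 0; rewrite /= mulr1.
have W1 : wint (1 : {poly R}) = pi / 2.
  by have := @wint_chebU R 0 0; rewrite /= mulr1.
elim/nat_ind2: n => [||n IH0 IH1]; first exact: pv_lim_1.
  have := pv_lim_linear (c := 2) (pv_lim_mulX pv_lim_1) pv_lim0.
  rewrite W1 /= -!mul_polyC !addr0 mulr1.
  rewrite mulrDr -polyCM (_ : 2 * (pi / 2) = pi); last by field.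
  by rewrite polyCN; congr pv_lim; ring.
have := pv_lim_linear (c := -1) IH0 (pv_lim_linear (c := 2) (pv_lim_mulX IH1) pv_lim0).
rewrite W0 polyC0 !addr0 chebUSS [chebT n.+3]chebTSS -!mul_polyC polyCN polyC1.
by congr pv_lim; ring.
Qed.

End HilbertTransformOfPhi.

(** * The [p j] as eigenfunctions of the hypersingular operator *)

Section HypersingularOperator.
Context {R : realType}.
Variables (p : nat -> {poly R}) (hp : orthonormal_phi p).
Implicit Types (q Q : {poly R}).

Lemma DAphi_pv_lim q Q : pv_lim q Q ->
  {in `]-1, 1[, forall y, DAphi (horner q) y = (- pi^-1 *: Q^`()).[y]}.
Proof.
move=> qQ.
have AE y : y \in `]-1, 1[ -> Aphi (horner q) y = (- pi^-1 *: Q).[y].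
  by move=> yI; rewrite /Aphi hornerZ; congr (_ * _); apply: cvg_lim => //; exact: qQ.
move=> y yI; rewrite -derivZ derivE /DAphi !derive1E.
(* [Aphi] is identified only inside the open interval, but a derivative depends only on values near
   [y]. *)
apply: near_eq_derive.
near=> z; apply: AE; near: z; exact: near_in_itvoo.
Unshelve. all: by end_near. Qed.

Lemma pv_lim_sum n (c : 'I_n -> R) (q Q : 'I_n -> {poly R}) :
  (forall i, pv_lim (q i) (Q i)) ->
  pv_lim (\sum_(i < n) c i *: q i) (\sum_(i < n) c i *: Q i).
Proof.
elim: n c q Q => [|n IHn] c q Q h; first by rewrite !big_ord0; exact: (@pv_lim0 R).
by rewrite !big_ord_recl; apply: pv_lim_linear => //; exact: IHn.
Qed.

Lemma DAphi_orthonormal n (c : 'I_n -> R) :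
  {in `]-1, 1[, forall y, DAphi (horner (\sum_(j < n) c j *: p j)) y =
    (\sum_(j < n) (c j * j.+1%:R) *: p j).[y]}.
Proof.
move=> y yI; have pp j : pv_lim (p j) (Num.sqrt (2 / pi) *: (- pi *: chebT j.+1)).
  have := pv_lim_linear (c := Num.sqrt (2 / pi)) (@pv_lim_chebU R j) (@pv_lim0 R).
  by rewrite !addr0 (orthonormal_chebU hp).
rewrite (DAphi_pv_lim (pv_lim_sum (c := c) (fun i : 'I_n => pp i)) yI).
congr (_.[y]); rewrite linear_sum/= scaler_sumr; apply: eq_bigr => j _.
rewrite !derivZ deriv_chebT (orthonormal_chebU hp) !scalerA; congr (_ *: _).
have /lt0r_neq0 pi0 := @pi_gt0 R.
move: (Num.sqrt _) => w; move: (@pi R) pi0 => P P0.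
by field.
Qed.

End HypersingularOperator.

(** * Sine kernels, their decay, and harmonic sums *)

Section TrigonometricKernels.
Context {R : realType}.
Implicit Types (a b z t : R) (n m : nat).

Lemma dirichlet_sum n z :
  2 * sin (z / 2) * (\sum_(j < n) cos (j.+1%:R * z)) =
  sin (n%:R * z + z / 2) - sin (z / 2).
Proof.
elim: n => [|n IHn]; first by rewrite big_ord0 mul0r add0r subrr mulr0.
rewrite big_ord_recr/= mulrDr IHn.
have -> : n%:R * z + z / 2 = n.+1%:R * z - z / 2 by rewrite -natr1; field.
rewrite sinB sinD; ring.
Qed.

(** Used with [c = 1] for interpolation and with [c j = j + 1] for the hypersingular part. *)
Definition sine_kernel (c : nat -> R) n a b :=
  \sum_(j < n) c j * (sin (j.+1%:R * a) * sin (j.+1%:R * b)).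

Lemma sine_kernelS c n a b : sine_kernel c n.+1 a b =
  sine_kernel c n a b + c n * (sin (n.+1%:R * a) * sin (n.+1%:R * b)).
Proof. exact: big_ord_recr. Qed.

Lemma norm_sin_halfB_le a b : 0 <= a <= pi -> 0 <= b <= pi ->
  `|sin ((a - b) / 2)| <= sin ((a + b) / 2).
Proof.
move=> /andP[a0 a1] /andP[b0 b1].
have pi0 := @pi_gt0 R.
have sa : 0 <= sin (a / 2) by apply: sin_ge0_pi; lra.
have sb : 0 <= sin (b / 2) by apply: sin_ge0_pi; lra.
have ca : 0 <= cos (a / 2) by apply: cos_ge0_pihalf; lra.
have cb : 0 <= cos (b / 2) by apply: cos_ge0_pihalf; lra.
rewrite mulrBl mulrDl sinB sinD ler_norml.
have h1 := mulr_ge0 sa cb; have h2 := mulr_ge0 ca sb.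
by apply/andP; split; lra.
Qed.

Lemma sine_kernel1_le n a b : `|sine_kernel (fun=> 1) n a b| <= n%:R.
Proof.
apply: (le_trans (ler_norm_sum _ _ _)).
apply: (@le_trans _ _ (\sum_(j < n) 1)); last by rewrite sumr_const card_ord.
apply: ler_sum => j _; rewrite mul1r normrM -[leRHS]mul1r.
by apply: ler_pM; rewrite ?sin_max.
Qed.

(** By product-to-sum, the kernel is a quarter of the difference of the Dirichlet kernels at [a - b]
    and [a + b]. Each is at most 1 after multiplication by its own half-angle sine, and for angles
    in [0, pi] the sine for [a - b] is dominated by the one for [a + b]. *)
Lemma sine_kernel1_sin_le n a b : 0 <= a <= pi -> 0 <= b <= pi ->
  `|sine_kernel (fun=> 1) n a b| * `|sin ((a - b) / 2)| <= 1.
Proof.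
move=> aI bI; have := norm_sin_halfB_le aI bI.
pose C z : R := \sum_(j < n) cos (j.+1%:R * z).
have CE z : `|sin (z / 2) * (2 * C z + 1)| <= 1.
  have -> : sin (z / 2) * (2 * C z + 1) = sin (n%:R * z + z / 2).
    by rewrite mulrDr mulr1 mulrCA mulrA dirichlet_sum subrK.
  exact: sin_max.
have -> : sine_kernel (fun=> 1) n a b = 4^-1 * ((2 * C (a - b) + 1) - (2 * C (a + b) + 1)).
  have -> : 4^-1 * ((2 * C (a - b) + 1) - (2 * C (a + b) + 1)) =
      2^-1 * (C (a - b) - C (a + b)) by field.
  rewrite -sumrB mulr_sumr; apply: eq_bigr => j _.
  by rewrite (mulrBr j.+1%:R) (mulrDr j.+1%:R) cosB cosD; field.
have := CE (a - b); have := CE (a + b); rewrite !normrM.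
set s := `|sin ((a - b) / 2)|; set s' := sin ((a + b) / 2).
set A := 2 * C (a - b) + 1; set B := 2 * C (a + b) + 1 => hB hA ss'.
have s0 : 0 <= s by exact: normr_ge0.
have hB' : s * `|B| <= 1.
  by apply: le_trans hB; rewrite ler_wpM2r// (le_trans ss')// ler_norm.
rewrite (ger0_norm (_ : 0 <= 4^-1))//.
have := ler_wpM2l s0 (ler_normB A B); nra.
Qed.

(** Term [j] occurs in the tails starting at [i = 0, ..., j], hence [j + 1] times. Every tail is a
    difference of two unweighted kernels, so the weights [j + 1] cost a factor [2 n]. *)
Lemma sine_kernel_abel n a b :
  sine_kernel (fun j => j.+1%:R) n a b =
  \sum_(i < n) (sine_kernel (fun=> 1) n a b - sine_kernel (fun=> 1) i a b).
Proof.
elim: n => [|n IHn]; first by rewrite /sine_kernel !big_ord0.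
rewrite sine_kernelS IHn [in RHS]big_ord_recr/= sine_kernelS.
under [in RHS]eq_bigr do rewrite addrAC.
rewrite [X in _ = X + _]big_split/= sumr_const card_ord -[_ *+ n]mulr_natl.
by rewrite -natr1; ring.
Qed.

Lemma sine_kernel_linear_le n a b :
  `|sine_kernel (fun j => j.+1%:R) n a b| <= 2 * n%:R * n%:R.
Proof.
rewrite sine_kernel_abel; apply: (le_trans (ler_norm_sum _ _ _)).
apply: (@le_trans _ _ (\sum_(j < n) (2 * n%:R))); last first.
  by rewrite sumr_const card_ord -[_ *+ n]mulr_natr.
apply: ler_sum => j _; rewrite (le_trans (ler_normB _ _))//.
have h1 := sine_kernel1_le n a b; have h2 := sine_kernel1_le j a b.
have : (j%:R : R) <= n%:R by rewrite ler_nat ltnW.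
lra.
Qed.

Lemma sine_kernel_linear_sin_le n a b : 0 <= a <= pi -> 0 <= b <= pi ->
  `|sine_kernel (fun j => j.+1%:R) n a b| * `|sin ((a - b) / 2)| <= 2 * n%:R.
Proof.
move=> aI bI; rewrite sine_kernel_abel.
apply: (@le_trans _ _ (\sum_(j < n) 2)); last first.
  by rewrite sumr_const card_ord -[_ *+ n]mulr_natr.
apply: (@le_trans _ _ ((\sum_(i < n) `|sine_kernel (fun=> 1) n a b -
   sine_kernel (fun=> 1) i a b|) * `|sin ((a - b) / 2)|)).
  by rewrite ler_wpM2r// ler_norm_sum.
rewrite mulr_suml; apply: ler_sum => j _.
have h1 := sine_kernel1_sin_le n aI bI; have h2 := sine_kernel1_sin_le j aI bI.
apply: (le_trans (ler_wpM2r (normr_ge0 _) (ler_normB _ _))).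
by rewrite mulrDl; lra.
Qed.

(** [sin z = 2 sin (z / 2) cos (z / 2)], and the mean value theorem turns this into [z] times two
    cosines of angles at most pi / 4, each at least [cos (pi / 4)], whose square is 1/2. *)
Lemma sin_ge_half z : 0 <= z <= pi / 2 -> z / 2 <= sin z.
Proof.
move=> /andP[z0 z1]; have pi0 := @pi_gt0 R.
have [c cI] : exists2 c, c \in `[0, z / 2] & sin (z / 2) - sin 0 = cos c * (z / 2 - 0).
  apply: (@MVT_segment R sin cos); first lra.
  by apply: continuous_subspaceT => x; exact: continuous_sin.
rewrite sin0 !subr0 => sE; move: cI; rewrite in_itv/= => /andP[c0 cz].
have -> : sin z = 2 * sin (z / 2) * cos (z / 2).
  by rewrite {1}(_ : z = z / 2 + z / 2); [rewrite sinD; ring|field].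
have cq : cos (pi / 4) ^+ 2 = 2^-1 :> R.
  have : cos (pi / 2) = cos (pi / 4) ^+ 2 *+ 2 - 1 :> R.
    by rewrite -cos_mulr2n; congr cos; rewrite -mulr_natl; field.
  rewrite cos_pihalf -mulr_natl; lra.
have cos_le x y : 0 <= x -> x <= y -> y <= pi -> cos y <= cos x.
  move=> x0 xy ypi; rewrite leNgt ltr_cos ?in_itv/=; [by rewrite -leNgt|lra|lra].
have c1 : cos (pi / 4) <= cos c by apply: cos_le; lra.
have c2 : cos (pi / 4) <= cos (z / 2) by apply: cos_le; lra.
have c4 : 0 <= cos (pi / 4 : R) by apply: cos_ge0_pihalf; lra.
have : cos (pi / 4) ^+ 2 <= cos c * cos (z / 2) by rewrite expr2 ler_pM.
rewrite cq sE => H.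
have -> : 2 * (cos c * (z / 2)) * cos (z / 2) = z * (cos c * cos (z / 2)).
  by field.
exact: ler_wpM2l.
Qed.

Definition harmonic_sum n : R := \sum_(0 <= j < n) j.+1%:R^-1.

Lemma harmonic_sumS n : harmonic_sum n.+1 = harmonic_sum n + n.+1%:R^-1.
Proof. exact: big_nat_recr. Qed.

Lemma harmonic_sum_ge0 n : 0 <= harmonic_sum n.
Proof. by apply: sumr_ge0 => i _; rewrite invr_ge0. Qed.

Lemma harmonic_sum_le m n : (m <= n)%N -> harmonic_sum m <= harmonic_sum n.
Proof.
move=> mn; rewrite /harmonic_sum [leRHS](@big_cat_nat _ _ _ m)//= lerDl.
by apply: sumr_ge0 => i _; rewrite invr_ge0.
Qed.

Lemma harmonic_sum_le_ln n : (0 < n)%N -> harmonic_sum n <= 1 + ln n%:R.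
Proof.
case: n => // n _; elim: n => [|n IHn].
  by rewrite /harmonic_sum big_nat1 invr1 ln1 addr0.
rewrite harmonic_sumS.
suff H : n.+2%:R^-1 <= ln n.+2%:R - ln n.+1%:R :> R.
  by move: (lerD IHn H); rewrite -[X in _ <= X]addrA (addrC (ln n.+1%:R)) subrK.
rewrite -opprB -ln_div ?posrE// lerNr.
have N0 : (n.+2%:R : R) != 0 by rewrite pnatr_eq0.
have -> : n.+1%:R / n.+2%:R = 1 + - n.+2%:R^-1 :> R.
  by apply: (mulIf N0); rewrite divfK// mulrDl mulNr mulVf// mul1r -[in RHS]natr1 addrK.
by apply: le_ln1Dx; rewrite ltrN2 invf_lt1// ltr1n.
Qed.

(** [k] marks the index near which the kernel peaks; each side of it is dominated by a harmonic sum.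
    It may exceed [m], hence the [minn]. *)
Lemma two_sided_harmonic_sum_le m k (w : nat -> R) :
  (forall j, (j < m)%N -> (j < k)%N -> w j <= (k - j)%:R^-1) ->
  (forall j, (j < m)%N -> (k <= j)%N -> w j <= (j - k).+1%:R^-1) ->
  \sum_(0 <= j < m) w j <= 2 * harmonic_sum m.
Proof.
move=> wlt wge; pose k' := minn k m.
have k'm : (k' <= m)%N by rewrite geq_minr.
rewrite (@big_cat_nat _ _ _ k')//= mulr_natl mulr2n lerD//.
  apply: le_trans (harmonic_sum_le k'm).
  rewrite /harmonic_sum big_nat_rev/= big_nat_cond [leRHS]big_nat_cond.
  apply: ler_sum => j /andP[/andP[_ jk'] _].
  apply: (le_trans (wlt _ _ _)); [lia|lia|].
  by rewrite lef_pV2 ?posrE ?ltr0n ?ler_nat; lia.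
apply: (@le_trans _ _ (harmonic_sum (m - k'))); last by apply: harmonic_sum_le; lia.
rewrite -{1}(add0n k') big_addn /harmonic_sum big_nat_cond [leRHS]big_nat_cond.
apply: ler_sum => j /andP[/andP[_ jk'] _].
apply: (le_trans (wge _ _ _)); [lia|lia|].
by rewrite lef_pV2 ?posrE ?ltr0n ?ler_nat; lia.
Qed.

End TrigonometricKernels.

(** * Weighted sums of decaying kernels over the angles [theta m j] *)

Section SumsOverChebyshevAngles.
Context {R : realType}.
Implicit Types (a b z t g d rho : R) (j m : nat).

Definition theta m j : R := j.+1%:R * pi / m.+1%:R.

Lemma theta_gt0 m j : 0 < theta m j.
Proof. by rewrite /theta divr_gt0// mulr_gt0// pi_gt0. Qed.

Lemma theta_reflect m j : (j < m)%N -> pi - theta m j = (m - j)%:R * pi / m.+1%:R.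
Proof.
move=> jm; have N0 : (m.+1%:R : R) != 0 by rewrite pnatr_eq0.
have -> : (m - j)%:R = m.+1%:R - j.+1%:R :> R.
  by rewrite -natrB; [congr _%:R; lia|lia].
by rewrite /theta; field; rewrite nat1r.
Qed.

Lemma theta_lt_pi m j : (j < m)%N -> theta m j < pi.
Proof.
move=> jm; rewrite -subr_gt0 theta_reflect// divr_gt0// mulr_gt0// ?pi_gt0//.
by rewrite ltr0n subn_gt0.
Qed.

Let frac_pi_ge m (k : R) : 0 <= k -> k / (2 * m.+1%:R) <= k * pi / m.+1%:R / 2 / 2.
Proof.
move=> k0; have pi2 := @pi_ge2 R.
have N0 : (0 : R) < m.+1%:R by rewrite ltr0n.
have -> : k * pi / m.+1%:R / 2 / 2 = (k / (2 * m.+1%:R)) * (pi / 2).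
  by move: (pi : R) N0 => P N0; field; rewrite nat1r gt_eqF.
by rewrite ler_peMr// ?divr_ge0// ?mulr_ge0//; lra.
Qed.

Lemma sin_half_theta_ge m j : (j < m)%N ->
  j.+1%:R / (2 * m.+1%:R) <= sin (theta m j / 2).
Proof.
move=> jm; have := theta_gt0 m j; have := theta_lt_pi jm => h1 h2.
apply: (@le_trans _ _ (theta m j / 2 / 2)); first exact: frac_pi_ge.
by apply: sin_ge_half; lra.
Qed.

Lemma cos_half_theta_ge m j : (j < m)%N ->
  (m - j)%:R / (2 * m.+1%:R) <= cos (theta m j / 2).
Proof.
move=> jm; have := theta_gt0 m j; have := theta_lt_pi jm => h1 h2.
have -> : cos (theta m j / 2) = sin ((pi - theta m j) / 2).
  by rewrite -[in RHS]cosBpihalf -[in LHS]cosN; congr cos; field.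
apply: (@le_trans _ _ ((pi - theta m j) / 2 / 2)).
  by rewrite theta_reflect//; exact: frac_pi_ge.
by apply: sin_ge_half; lra.
Qed.

Lemma norm_sin_half_ge z : `|z| <= pi -> `|z| / 4 <= `|sin (z / 2)|.
Proof.
move=> zpi; have -> : `|sin (z / 2)| = `|sin (`|z| / 2)|.
  by have [_|_] := ger0P z => //; rewrite mulNr sinN normrN.
have := normr_ge0 z => z0.
have h : `|z| / 2 / 2 <= sin (`|z| / 2) by apply: sin_ge_half; lra.
by rewrite (le_trans _ (ler_norm _))//; lra.
Qed.

Section WeightedSum.
Variables (m : nat) (t M : R) (A : nat -> R).
Hypotheses (M0 : 0 < M) (tI : 0 <= t <= pi).
Hypotheses (A_le : forall j, (j < m)%N -> `|A j| <= M * m%:R)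
  (A_sin_le : forall j, (j < m)%N -> `|A j| * `|sin ((theta m j - t) / 2)| <= M).

Local Notation N := (m.+1%:R : R).

Let N0 : 0 < N. Proof. by rewrite ltr0n. Qed.

Let MN : M * m%:R <= N * M.
Proof. by rewrite mulrC ler_wpM2r ?(ltW M0)// ler_nat. Qed.

(** In units of [pi / N] the angles are the integers [j + 1] and [t] becomes [tau], with integer
    part [k]. The decay gives [|A j| * |tau - (j + 1)| <= 2 N M]; adding [|A j| <= N M] yields
    [3 N M] over [|tau - (j + 1)| + 1], which is at least [k - j] or [j - k + 1]. The two sides make
    6. *)
Let sum_A_le : \sum_(0 <= j < m) `|A j| <= 6 * (M * N * harmonic_sum m).
Proof.
have pi0 := @pi_gt0 R; have pi2 := @pi_ge2 R.
move: tI => /andP[t0 t1].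
have [tau tau0 tE] : exists2 tau, 0 <= tau & t = tau * (pi / N).
  exists (t * N / pi); first by rewrite divr_ge0 ?mulr_ge0// ltW.
  by move: (pi : R) pi0 N0 => P P0 n0; field; rewrite !gt_eqF.
have [k [ktau tauk]] : exists k : nat, k%:R <= tau /\ tau < k%:R + 1.
  by exists (Num.truncn tau); have /andP[] := truncn_itv tau0; rewrite -natr1.
have bnd j : (j < m)%N -> `|A j| * `|tau - j.+1%:R| <= 2 * N * M.
  move=> jm; have h1 := theta_gt0 m j; have h2 := theta_lt_pi jm.
  have hz : `|theta m j - t| <= pi by rewrite ler_norml; apply/andP; split; lra.
  have := norm_sin_half_ge hz; have := A_sin_le jm.
  have -> : theta m j - t = (j.+1%:R - tau) * (pi / N).
    by rewrite /theta tE; move: (pi : R) N0 => P n0; field; rewrite gt_eqF.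
  have piN : 0 <= pi / N by rewrite divr_ge0// ltW.
  move=> H; rewrite normrM (ger0_norm piN) distrC => h.
  have h4 : `|tau - j.+1%:R| / (2 * N) <= `|sin ((j.+1%:R - tau) * (pi / N) / 2)|.
    apply: le_trans h.
    have -> : `|tau - j.+1%:R| * (pi / N) / 4 =
        `|tau - j.+1%:R| / (2 * N) * (pi / 2).
      by move: (pi : R) N0 => P n0; field; rewrite gt_eqF.
    have pos : 0 <= `|tau - j.+1%:R| / (2 * N) by rewrite divr_ge0.
    by rewrite ler_peMr//; lra.
  have := le_trans (ler_wpM2l (normr_ge0 (A j)) h4) H.
  by rewrite mulrA ler_pdivrMr ?mulr_gt0// [M * _]mulrC.
have C0 : 0 < 3 * N * M by rewrite !mulr_gt0.
have : \sum_(0 <= j < m) (`|A j| / (3 * N * M)) <= 2 * harmonic_sum m.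
  apply: (@two_sided_harmonic_sum_le _ _ k) => j jm jk.
    rewrite ler_pdivrMr// mulrC ler_pdivlMr ?ltr0n ?subn_gt0//.
    have kj : (k - j)%:R <= `|tau - j.+1%:R| + 1.
      rewrite natrB ?(ltnW jk)//.
      apply: (le_trans (y := tau - j.+1%:R + 1)); last by rewrite lerD2r ler_norm.
      by rewrite -natr1 opprD addrA subrK lerD2r.
    have := ler_wpM2l (normr_ge0 (A j)) kj; rewrite mulrDr mulr1.
    have := bnd j jm; have := A_le jm; move: MN; lra.
  rewrite ler_pdivrMr// mulrC ler_pdivlMr ?ltr0n//.
  have kj : (j - k).+1%:R <= `|tau - j.+1%:R| + 1.
    rewrite -natr1 natrB// lerD2r distrC; 
    apply: le_trans (_ : j.+1%:R - tau <= _); last by rewrite ler_norm.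
    rewrite -natr1; move: tauk ktau; lra.
  have := ler_wpM2l (normr_ge0 (A j)) kj; rewrite mulrDr mulr1.
  have := bnd j jm; have := A_le jm; move: MN; lra.
rewrite -mulr_suml ler_pdivrMr// => /le_trans; apply.
by rewrite le_eqVlt; apply/orP; left; apply/eqP; ring.
Qed.

(** In the last two terms the sine cancels against the decay of [A], leaving [2 N M / (j + 1)] and
    [2 N M / (m - j)]; hence 22 = 3 * 6 + 2 + 2. *)
Lemma weighted_theta_sum_le :
  \sum_(0 <= j < m) `|A j| * (3 + `|sin ((theta m j - t) / 2)| / sin (theta m j / 2)
      + `|sin ((theta m j - t) / 2)| / cos (theta m j / 2))
  <= 22 * (M * N * harmonic_sum m).
Proof.
have -> : 22 * (M * N * harmonic_sum m) = 3 * (6 * (M * N * harmonic_sum m))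
  + 2 * N * M * harmonic_sum m + 2 * N * M * harmonic_sum m by ring.
apply: (@le_trans _ _ (\sum_(0 <= j < m) (3 * `|A j| + 2 * N * M * j.+1%:R^-1 +
    2 * N * M * (m - j)%:R^-1))).
  rewrite big_nat_cond [leRHS]big_nat_cond; apply: ler_sum => j /andP[/andP[_ jm] _].
  have inv_le (v : R) (n : nat) : (0 < n)%N -> n%:R / (2 * N) <= v ->
      `|A j| * (`|sin ((theta m j - t) / 2)| / v) <= 2 * N * M * n%:R^-1.
    move=> n0 nv; have n0' : 0 < (n%:R : R) by rewrite ltr0n.
    have v0 : 0 < v by apply: lt_le_trans nv; rewrite divr_gt0// mulr_gt0.
    rewrite mulrA; apply: (@le_trans _ _ (M / v)).
      by rewrite ler_wpM2r ?invr_ge0 ?(ltW v0)// A_sin_le.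
    have := ler_wpM2l (ltW M0) nv; rewrite mulrA ler_pdivrMr ?mulr_gt0// => H.
    rewrite ler_pdivrMr// mulrAC ler_pdivlMr//.
    by move: H; rewrite [M * v * _]mulrC (mulrA _ M).
  have hs := inv_le _ j.+1 (ltn0Sn _) (sin_half_theta_ge jm).
  have hc := inv_le _ (m - j)%N (etrans (subn_gt0 _ _) jm) (cos_half_theta_ge jm).
  by rewrite (mulrDr _ (3 + _)) (mulrDr _ 3) (mulrC _ 3) !lerD.
rewrite !big_split/= -!mulr_sumr !lerD//.
- by rewrite ler_wpM2l.
- rewrite ler_wpM2l ?mulr_ge0 ?(ltW M0)//.
  rewrite /harmonic_sum big_nat_rev/= big_nat_cond [leRHS]big_nat_cond.
  apply: ler_sum => j /andP[/andP[_ jm] _].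
  by rewrite lef_pV2 ?posrE ?ltr0n ?ler_nat; lia.
Qed.

End WeightedSum.

(** As [2 g <= 1 <= rho], the power [rho ^ (2 g)] is at most [rho]: this is where exponents up to
    1/2 enter. *)
Lemma powR_le_scaled x y rho g : 0 <= x -> 0 <= y -> 1 <= rho ->
  0 <= g <= 2^-1 -> x <= y * rho ^+ 2 -> x `^ g <= y `^ g * rho.
Proof.
move=> x0 y0 rho1 /andP[g0 g1] xy.
have rho0 : 0 <= rho by lra.
apply: (@le_trans _ _ ((y * rho ^+ 2) `^ g)).
  by apply: ge0_ler_powR; rewrite ?nnegrE// mulr_ge0// exprn_ge0.
rewrite powRM ?exprn_ge0// ler_wpM2l ?powR_ge0//.
apply: (@le_trans _ _ ((rho ^+ 2) `^ 2^-1)).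
  by apply: ler_powR => //; rewrite exprn_ege1.
by rewrite powR12_sqrt ?exprn_ge0// sqrtr_sqr ger0_norm.
Qed.

Lemma jacobi_cos_le g d t a : 0 <= g <= 2^-1 -> 0 <= d <= 2^-1 ->
  0 <= t <= pi -> 0 < a < pi ->
  jacobi g d (cos t) <= jacobi g d (cos a) *
    (3 + `|sin ((a - t) / 2)| / sin (a / 2) + `|sin ((a - t) / 2)| / cos (a / 2)).
Proof.
move=> gI dI /andP[t0 t1] /andP[a0 a1]; have pi0 := @pi_gt0 R.
have cosE z : 1 - cos z = 2 * sin (z / 2) ^+ 2 /\ 1 + cos z = 2 * cos (z / 2) ^+ 2.
  have -> : cos z = cos (z / 2) ^+ 2 - sin (z / 2) ^+ 2.
    by rewrite {1}(splitr z) cosD -!expr2.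
  by have := cos2Dsin2 (z / 2); lra.
rewrite /jacobi; have [-> ->] := cosE t; have [-> ->] := cosE a.
set s := `|_|; have s0 : 0 <= s by exact: normr_ge0.
have sa : 0 < sin (a / 2) by apply: sin_gt0_pi; lra.
have ca : 0 < cos (a / 2) by apply: cos_gt0_pihalf; lra.
have st : 0 <= sin (t / 2) by apply: sin_ge0_pi; lra.
have ct : 0 <= cos (t / 2) by apply: cos_ge0_pihalf; lra.
have tE : t / 2 = a / 2 - (a - t) / 2 by field.
have sts : sin (t / 2) <= sin (a / 2) + s.
  rewrite tE sinB lerD//.
    by rewrite ler_piMr ?(ltW sa)// cos_le1.
  rewrite -mulNr; apply: (le_trans (ler_norm _)); rewrite normrM normrN.
  by rewrite ler_piMl// cos_max.
have cts : cos (t / 2) <= cos (a / 2) + s.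
  rewrite tE cosB lerD//.
    by rewrite ler_piMr ?(ltW ca)// cos_le1.
  by apply: (le_trans (ler_norm _)); rewrite normrM ler_piMl// sin_max.
have sc_le (x y : R) : 0 < x -> 0 <= y -> y <= x + s ->
    2 * y ^+ 2 <= 2 * x ^+ 2 * (1 + s / x) ^+ 2 /\ 1 <= 1 + s / x.
  move=> x0 y0 yxs; split; last by rewrite lerDl divr_ge0// ltW.
  rewrite -mulrA ler_wpM2l// -exprMn mulrDr mulr1 mulrCA divff ?gt_eqF// mulr1.
  by rewrite ler_pXn2r// nnegrE ltW// (lt_le_trans x0)// lerDl.
have sq_le (x y : R) : 0 <= y -> y <= x -> 2 * y ^+ 2 <= 2 * x ^+ 2.
  by move=> y0 yx; rewrite ler_wpM2l// ler_pXn2r// nnegrE (le_trans y0).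
have pos2 (x : R) : 0 <= 2 * x ^+ 2 by rewrite mulr_ge0// sqr_ge0.
have sqt := cos2Dsin2 (t / 2); have sqa := cos2Dsin2 (a / 2).
have hs0 : 0 <= s / sin (a / 2) by rewrite divr_ge0// ltW.
have hc0 : 0 <= s / cos (a / 2) by rewrite divr_ge0// ltW.
have g0 : 0 <= g by case/andP: gI.
have d0 : 0 <= d by case/andP: dI.
(* Of [sin (t / 2)] and [cos (t / 2)], one is at most its counterpart at [a], since the squares sum
   to 1. So only the other factor of the weight has to be enlarged, and no product of two correction
   terms arises. *)
have [ts|ts] := lerP (sin (t / 2)) (sin (a / 2)).
  have [h1 h2] := sc_le _ _ ca ct cts.
  have H := powR_le_scaled (pos2 _) (pos2 _) h2 dI h1.
  have G : (2 * sin (t / 2) ^+ 2) `^ g <= (2 * sin (a / 2) ^+ 2) `^ g.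
    by apply: ge0_ler_powR; rewrite ?nnegrE ?pos2//; exact: sq_le.
  apply: (le_trans (ler_pM (powR_ge0 _ _) (powR_ge0 _ _) G H)).
  rewrite mulrA ler_wpM2l ?mulr_ge0 ?powR_ge0//; lra.
have cct : cos (t / 2) <= cos (a / 2).
  by rewrite -(@ler_pXn2r _ 2)// ?nnegrE ?(ltW ca)//; nra.
have [h1 h2] := sc_le _ _ sa st sts.
have H := powR_le_scaled (pos2 _) (pos2 _) h2 gI h1.
have G : (2 * cos (t / 2) ^+ 2) `^ d <= (2 * cos (a / 2) ^+ 2) `^ d.
  by apply: ge0_ler_powR; rewrite ?nnegrE ?pos2//; exact: sq_le.
apply: (le_trans (ler_pM (powR_ge0 _ _) (powR_ge0 _ _) H G)).
rewrite mulrAC ler_wpM2l ?mulr_ge0 ?powR_ge0//; lra.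
Qed.


End SumsOverChebyshevAngles.

(** * Nodes and Gauss weights in the angular variable *)

Section ChebyshevNodes.
Context {R : realType}.
Variables (p : nat -> {poly R}) (hp : orthonormal_phi p).
Variables (m : nat) (x : 'I_m -> R).
Hypotheses (x_inj : injective x) (px0 : forall i, root (p m) (x i)).

Local Notation N := (m.+1%:R : R).

Lemma theta_itv (j : 'I_m) : 0 < (theta m j : R) < pi.
Proof. by rewrite theta_gt0 theta_lt_pi. Qed.

Lemma theta_segment (j : 'I_m) : 0 <= (theta m j : R) <= pi.
Proof. by have /andP[? ?] := theta_itv j; rewrite !ltW. Qed.

Lemma sin_theta_gt0 (j : 'I_m) : 0 < sin (theta m j : R).
Proof. exact/sin_gt0_pi/theta_itv. Qed.

(** The cosines of the angles are m distinct roots of [p m], whose degree leaves room for no other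
    root. The relabelling [l] is injective, so sums over the nodes can be reindexed by the
    angles. *)
Lemma nodes_theta : exists2 l : 'I_m -> 'I_m, injective l &
  forall i, x i = cos (theta m (l i)).
Proof.
have N0 : N != 0 by rewrite pnatr_eq0.
have th_inj : injective (fun j : 'I_m => cos (theta m j) : R).
  move=> i j; have := @cos_inj R (theta m i) (theta m j).
  rewrite !in_itv/= !theta_segment => H /(H isT isT) E.
  have {}E : (i.+1%:R : R) = j.+1%:R.
    have Npi : (pi : R) / N != 0 by rewrite mulf_neq0 ?invr_eq0// gt_eqF// pi_gt0.
    by apply: (mulIf Npi); rewrite !mulrA; exact: E.
  by apply/val_inj; move/eqP: E; rewrite eqr_nat => /eqP[].
have pm0 : p m != 0 by rewrite -size_poly_gt0; case: hp => ->.
have th_root (j : 'I_m) : root (p m) (cos (theta m j)).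
  apply/eqP/(mulIf (lt0r_neq0 (sin_theta_gt0 j))).
  rewrite mul0r (orthonormal_cos hp) /theta mulrC.
  have -> : m.+1%:R * (j.+1%:R * pi / m.+1%:R) = j.+1%:R * pi :> R by rewrite mulrC divfK.
  by rewrite sin_nat_pi mul0r.
have xth i : x i \in codom (fun j : 'I_m => cos (theta m j) : R).
  apply/negPn/negP => xi.
  have := @max_poly_roots _ (p m) (x i :: codom (fun j : 'I_m => cos (theta m j) : R)) pm0.
  rewrite /= px0 xi (map_inj_uniq th_inj) enum_uniq size_codom card_ord.
  case: hp => -> _ _; rewrite ltnn => H.
  suff /H : all (root (p m)) (codom (fun j : 'I_m => cos (theta m j) : R)) by move=> /(_ isT).
  by apply/allP => _ /codomP[j ->]; exact: th_root.
pose l i := iinv (xth i).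
have lE i : x i = cos (theta m (l i)) by rewrite /l (f_iinv (xth i)).
by exists l => // i j lij; apply: x_inj; rewrite !lE lij.
Qed.

Lemma sum_sin_sqr_theta (j : 'I_m) :
  \sum_(i < m) sin (i.+1%:R * theta m j) ^+ 2 = N / 2 :> R.
Proof.
have N0 : N != 0 by rewrite pnatr_eq0.
set t := theta m j.
have st : sin t != 0 by rewrite gt_eqF// sin_theta_gt0.
have : \sum_(i < m) cos (i.+1%:R * (2 * t)) = -1.
  apply: (mulfI (_ : 2 * sin (2 * t / 2) != 0)).
    by rewrite mulf_neq0// mulrAC mulfV// mul1r.
  rewrite dirichlet_sum.
  have -> : 2 * t / 2 = t by field.
  (* [(m + 1) t = (j + 1) pi], so the last sine of the Dirichlet sum is [- sin t] and the sum of
     cosines is -1. *)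
  have -> : m%:R * (2 * t) + t = j.+1%:R * pi + j.+1%:R * pi - t.
    by rewrite /t /theta; move: (pi : R) => P; field; rewrite nat1r.
  rewrite sinB cosD sinD !sin_nat_pi -expr2 cos_nat_pi_sqr; ring.
move=> C; have : \sum_(i < m) (1 - 2 * sin (i.+1%:R * t) ^+ 2) = -1.
  rewrite -C; apply: eq_bigr => i _.
  have -> : i.+1%:R * (2 * t) = (i.+1%:R * t) *+ 2 by rewrite mulr2n; ring.
  by rewrite cos_mulr2n cos2sin2 mulr2n; ring.
rewrite sumrB sumr_const card_ord -mulr_sumr; set S := \sum_(_ < _) _ => H.
by rewrite -(natr1 m); lra.
Qed.

Lemma christoffel_theta i (j : 'I_m) : x i = cos (theta m j) ->
  christoffel x i = pi / N * sin (theta m j) ^+ 2.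
Proof.
move=> xij; have pi0 := @pi_gt0 R; have s0 := sin_theta_gt0 j.
have S : (\sum_(k < m) (p k).[x i] ^+ 2) * sin (theta m j) ^+ 2 = N / pi.
  rewrite mulr_suml.
  have -> : N / pi = 2 / pi * (N / 2) by rewrite [RHS]mulrC mulrA divfK.
  rewrite -(sum_sin_sqr_theta j) mulr_sumr; apply: eq_bigr => k _.
  rewrite -exprMn xij (orthonormal_cos hp) exprMn sqr_sqrtr//.
  by rewrite divr_ge0 ?(ltW pi0).
have := christoffel_inv x_inj hp px0 i => C.
have N0 : N != 0 by rewrite pnatr_eq0.
have NP : N / pi != 0 by rewrite mulf_neq0// invr_eq0 gt_eqF.
apply: (mulIf NP).
rewrite -[in LHS]S mulrA C mul1r mulrAC.
by rewrite (mulrA (pi / N)) divfK// divff ?mul1r ?gt_eqF.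
Qed.

Lemma christoffel_ge0 i : 0 <= christoffel x i.
Proof.
have [l _ lE] := nodes_theta; rewrite (christoffel_theta (lE i)).
by rewrite mulr_ge0 ?sqr_ge0// divr_ge0// pi_ge0.
Qed.

Lemma node_itv i : x i \in `]-1, 1[.
Proof.
have [l _ lE] := nodes_theta; rewrite lE in_itv/=.
have s0 := sin_theta_gt0 (l i); have := cos2Dsin2 (theta m (l i) : R).
move=> E; have s2 := exprn_gt0 2 s0; rewrite -ltr_norml -(@ltr_pXn2r _ 2) ?nnegrE//.
by rewrite real_normK ?num_real// expr1n; lra.
Qed.

Section JacobiWeight.
Variables (g d : R) (gI : 0 <= g <= 2^-1) (dI : 0 <= d <= 2^-1).

Local Notation u := (jacobi g d).

Lemma jacobi_gt0 y : y \in `]-1, 1[ -> 0 < u y.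
Proof.
by rewrite in_itv/= => /andP[y1 y2]; rewrite mulr_gt0// powR_gt0//; lra.
Qed.

(** On [0, 2], [sqrt z = z ^ (1/2 - e) * z ^ e <= 2 * z ^ e] when [e] is in [0, 1/2]; each endpoint
    contributes one factor 2. *)
Lemma phi_le_jacobi y : y \in `[(-1), 1] -> phi y <= 4 * u y.
Proof.
rewrite in_itv/= => /andP[y1 y2].
have le2 (z e : R) : 0 <= z <= 2 -> 0 <= e <= 2^-1 -> Num.sqrt z <= 2 * z `^ e.
  move=> /andP[z0 z2] /andP[e0 e1].
  have [->|zn0] := eqVneq z 0; first by rewrite sqrtr0 mulr_ge0// powR_ge0.
  rewrite -powR12_sqrt// -[X in z `^ X](subrK e) powRD; last by rewrite zn0 implybT.
  rewrite ler_wpM2r ?powR_ge0//; apply: (@le_trans _ _ (2 `^ (2^-1 - e))).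
    by apply: ge0_ler_powR; rewrite ?nnegrE//; lra.
  rewrite -[leRHS]powRr1//; apply: ler_powR; lra.
rewrite /phi /jacobi -[X in X - _](expr1n _ 2) subr_sqr sqrtrM; last by lra.
have h1 : Num.sqrt (1 - y) <= 2 * (1 - y) `^ g by apply: le2 => //; lra.
have h2 : Num.sqrt (1 + y) <= 2 * (1 + y) `^ d by apply: le2 => //; lra.
apply: le_trans (ler_pM (sqrtr_ge0 _) (sqrtr_ge0 _) h1 h2) _.
by rewrite le_eqVlt; apply/orP; left; apply/eqP; ring.
Qed.

(** Each term equals [pi / N * phi / u], at most [16 / N] because [pi <= 4] and [phi <= 4 u]. It
    controls the contribution of the kernel [k]. *)
Lemma christoffel_weight_sum_le :
  \sum_(i < m) christoffel x i / (u (x i) * phi (x i)) <= 16.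
Proof.
have pi0 := @pi_gt0 R.
have pi4 : pi <= 4 :> R by have := @pihalf_lt2 R; lra.
apply: (@le_trans _ _ (\sum_(i < m) (16 / N))).
  have [l _ lE] := nodes_theta; apply: ler_sum => i _.
  have xI := node_itv i; have u0 := jacobi_gt0 xI; have p0 := phi_gt0 xI.
  rewrite (christoffel_theta (lE i)).
  have -> : sin (theta m (l i)) = phi (x i) by rewrite lE phi_cos// theta_segment.
  have xI' : x i \in `[(-1), 1] by apply: subset_itv_oo_cc xI.
  have := phi_le_jacobi xI' => h.
  have -> : pi / N * phi (x i) ^+ 2 / (u (x i) * phi (x i)) = (pi * phi (x i) / u (x i)) / N.
    by move: (pi : R) => P; field; rewrite !gt_eqF//= nat1r pnatr_eq0.
  rewrite ler_wpM2r ?invr_ge0// ler_pdivrMr//.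
  by apply: le_trans (ler_pM (ltW pi0) (ltW p0) pi4 h) _; lra.
rewrite sumr_const card_ord -[_ *+ m]mulr_natl mulrCA mulrC -ler_pdivlMr// divff//.
by rewrite ler_pdivrMr// mul1r ler_nat.
Qed.

(* With [x i = cos theta] and [y = cos t], [p_j phi = sqrt (2 / pi) sin ((j + 1) t)] and
   [christoffel x i = pi phi (x i) ^ 2 / (m + 1)] turn the sum into [2 / (m + 1)]
   times a sine kernel. *)
Lemma weighted_kernel_theta (c : nat -> R) i (j : 'I_m) t : x i = cos (theta m j) ->
  0 <= t <= pi ->
  phi (cos t) * (christoffel x i / phi (x i)) *
    (\sum_(k < m) (p k).[x i] * (c k * (p k).[cos t])) =
  2 / N * sine_kernel c m (theta m j) t.
Proof.
move=> xij tI; have pi0 := @pi_gt0 R; have s0 := sin_theta_gt0 j.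
have N0 : N != 0 by rewrite pnatr_eq0.
rewrite (christoffel_theta xij) {1 2}xij !phi_cos ?theta_segment//.
rewrite (_ : pi / N * sin (theta m j) ^+ 2 / sin (theta m j) = pi / N * sin (theta m j)); last first.
  by rewrite expr2 mulrA mulfK// gt_eqF.
rewrite mulr_sumr /sine_kernel mulr_sumr.
apply: eq_bigr => k _.
have := orthonormal_cos hp k (theta m j); rewrite -xij => E1.
have := orthonormal_cos hp k t => E2.
have W : Num.sqrt (2 / pi) * Num.sqrt (2 / pi) = 2 / pi :> R.
  by rewrite -expr2 sqr_sqrtr// divr_ge0// ltW.
transitivity (pi / N * c k * ((p k).[x i] * sin (theta m j)) * ((p k).[cos t] * sin t)); first by ring.
rewrite E1 E2.
transitivity (pi / N * c k * (Num.sqrt (2 / pi) * Num.sqrt (2 / pi)) *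
   (sin (k.+1%:R * theta m j) * sin (k.+1%:R * t))); first by ring.
rewrite W; move: (pi : R) pi0 => P P0.
by field; rewrite nat1r N0 gt_eqF.
Qed.

(** Applied with [c = 1], [M = 1] for the Lebesgue constant, and with [c j = j + 1], [M = 2 m] for
    the hypersingular part. The 44 is the factor 2 of [2 / N] times 22. *)
Lemma weighted_kernel_sum_le (c : nat -> R) (M y : R) : 0 < M -> y \in `[(-1), 1] ->
  (forall a b, `|sine_kernel c m a b| <= M * m%:R) ->
  (forall a b, 0 <= a <= pi -> 0 <= b <= pi ->
     `|sine_kernel c m a b| * `|sin ((a - b) / 2)| <= M) ->
  \sum_(i < m) `|u y * phi y * (christoffel x i / (u (x i) * phi (x i))) *
    (\sum_(k < m) (p k).[x i] * (c k * (p k).[y]))| <= 44 * M * harmonic_sum m.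
Proof.
move=> M0 yI ck cks; have [l l_inj lE] := nodes_theta.
have N0 : 0 < N by rewrite ltr0n.
set t := acos y; have yE : y = cos t by rewrite /t acosK.
have tI : 0 <= t <= pi.
  by move: yI; rewrite in_itv/= => yI; rewrite acos_ge0// acos_lepi.
have gpos : 0 <= u (cos t) by rewrite mulr_ge0 ?powR_ge0.
apply: (@le_trans _ _ (\sum_(i < m) (2 / N * (`|sine_kernel c m (theta m (l i)) t| *
   (3 + `|sin ((theta m (l i) - t) / 2)| / sin (theta m (l i) / 2)
    + `|sin ((theta m (l i) - t) / 2)| / cos (theta m (l i) / 2)))))).
  apply: ler_sum => i _; have u0 := jacobi_gt0 (node_itv i).
  rewrite {1 2 3}yE (_ : _ * _ = (u (cos t) / u (x i)) * (phi (cos t) * (christoffel x i / phi (x i)) *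
    (\sum_(k < m) (p k).[x i] * (c k * (p k).[cos t])))); last first.
    by rewrite -yE; field; rewrite !gt_eqF// phi_gt0// node_itv.
  rewrite (weighted_kernel_theta c (lE i) tI) normrM mulrC normrM.
  rewrite (ger0_norm (_ : 0 <= 2 / N)) ?divr_ge0// -(mulrA (2 / N)) ler_wpM2l ?divr_ge0//.
  rewrite ler_wpM2l// ger0_norm; last by rewrite divr_ge0// ltW.
  rewrite ler_pdivrMr// mulrC {1}lE; apply: jacobi_cos_le => //.
  exact: theta_itv.
rewrite -mulr_sumr.
pose F (j : nat) := `|sine_kernel c m (theta m j) t| *
   (3 + `|sin ((theta m j - t) / 2)| / sin (theta m j / 2)
    + `|sin ((theta m j - t) / 2)| / cos (theta m j / 2)).
have -> : \sum_(i < m) (`|sine_kernel c m (theta m (l i)) t| *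
   (3 + `|sin ((theta m (l i) - t) / 2)| / sin (theta m (l i) / 2)
    + `|sin ((theta m (l i) - t) / 2)| / cos (theta m (l i) / 2))) = \sum_(0 <= j < m) F j.
  by rewrite big_mkord [RHS](reindex_inj l_inj).
have thI j : (j < m)%N -> 0 <= (theta m j : R) <= pi.
  by move=> jm; exact: (theta_segment (Ordinal jm)).
have := @weighted_theta_sum_le R m t M (fun j => sine_kernel c m (theta m j) t) M0 tI.
move=> /(_ (fun j _ => ck _ _) (fun j jm => cks _ _ (thI j jm) tI)) H.
apply: (@le_trans _ _ (2 / N * (22 * (M * N * harmonic_sum m)))).
  by rewrite ler_wpM2l// divr_ge0// ltW.
by rewrite le_eqVlt; apply/orP; left; apply/eqP; field; rewrite nat1r gt_eqF.
Qed.

End JacobiWeight.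
End ChebyshevNodes.

(** * Weighted interpolation bounds and integrals against [h] *)

Section CollocationMatrix.
Context {R : realType}.
Let mu := @lebesgue_measure R.
Variables (p : nat -> {poly R}) (hp : orthonormal_phi p).
Variables (m : nat) (x : 'I_m -> R).
Hypotheses (x_inj : injective x) (px0 : forall i, root (p m) (x i)).
Variables (g d : R) (gI : 0 <= g <= 2^-1) (dI : 0 <= d <= 2^-1).

Implicit Types (q : {poly R}).

Local Notation u := (jacobi g d).
Local Notation I := (`[(-1), 1]%classic : set R).

Definition uphi (y : R) : R := u y * phi y.

Lemma uphi_gt0 y : y \in `]-1, 1[ -> 0 < uphi y.
Proof. by move=> yI; rewrite mulr_gt0 ?phi_gt0// jacobi_gt0. Qed.

Lemma uphi_ge0 y : 0 <= uphi y.
Proof. by rewrite !mulr_ge0 ?powR_ge0// phi_ge0. Qed.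

Lemma uphi_node_gt0 i : 0 < uphi (x i).
Proof. exact/uphi_gt0/(node_itv hp x_inj px0). Qed.

Lemma uphi_jacobi y : y \in `[(-1), 1] -> jacobi (g + 2^-1) (d + 2^-1) y = uphi y.
Proof. by move=> yI; rewrite -jacobi_phi//; [case/andP: gI|case/andP: dI]. Qed.

Lemma Cnorm_le (f : R -> R) (M : R) :
  (forall y, y \in `[(-1), 1] -> `|f y| * uphi y <= M) ->
  (Cnorm (g + 2^-1) (d + 2^-1) f <= M%:E)%E.
Proof.
move=> fM; apply: ge_ereal_sup => _ [y yI <-]; rewrite lee_fin.
by rewrite uphi_jacobi// normrM (ger0_norm (uphi_ge0 y)) fM.
Qed.

Lemma le_Cnorm (f : R -> R) y : y \in `[(-1), 1] ->
  ((`|f y| * uphi y)%:E <= Cnorm (g + 2^-1) (d + 2^-1) f)%E.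
Proof.
move=> yI; apply: ereal_sup_ubound; exists y => //=.
by rewrite uphi_jacobi// normrM (ger0_norm (uphi_ge0 y)).
Qed.

Definition lebesgue_bound : R := 44 * harmonic_sum m.

Lemma interp_uphi_le (G : R -> R) (B y : R) : 0 <= B ->
  (forall i, `|G (x i)| * uphi (x i) <= B) ->
  y \in `[(-1), 1] -> `|(interp x G).[y]| * uphi y <= lebesgue_bound * B.
Proof.
move=> B0 GB yI.
have L := @weighted_kernel_sum_le R p hp m x x_inj px0 g d gI dI (fun=> 1) 1 y ltr01 yI.
have {}L : \sum_(i < m) `|u y * phi y * (christoffel x i / (u (x i) * phi (x i))) *
    (\sum_(k < m) (p k).[x i] * (1 * (p k).[y]))| <= lebesgue_bound.
  rewrite /lebesgue_bound -[44]mulr1; apply: L => [a b|a b aI bI].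
    by rewrite mul1r; exact: sine_kernel1_le.
  exact: sine_kernel1_sin_le.
apply: le_trans (ler_wpM2r B0 L).
rewrite -(ger0_norm (uphi_ge0 y)) -normrM /interp horner_sum mulr_suml.
apply: (le_trans (ler_norm_sum _ _ _)); rewrite mulr_suml.
apply: ler_sum => i _; have ui := uphi_node_gt0 i.
rewrite hornerZ (lagr_expansion x_inj hp px0) hornerZ horner_sum.
under eq_bigr do rewrite hornerZ.
under [in leRHS]eq_bigr do rewrite mul1r.
set S := \sum_(_ < _) _.
have -> : G (x i) * (christoffel x i * S) * uphi y =
    (u y * phi y * (christoffel x i / (u (x i) * phi (x i))) * S) * (G (x i) * uphi (x i)).
  have := lt0r_neq0 ui; rewrite /uphi mulf_eq0 negb_or => /andP[u0 p0].
  by field; rewrite u0 p0.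
rewrite normrM ler_wpM2l// normrM (ger0_norm (ltW ui)); exact: GB.
Qed.

(** [interp] takes a function on the whole line, so values prescribed by index have to be carried
    over to the points; injectivity of [x] makes this consistent. *)
Lemma interp_uphi_node (w : 'I_m -> R) : exists G : R -> R,
  forall i, G (x i) * uphi (x i) = w i.
Proof.
exists (fun y => if [pick i | x i == y] is Some i then w i / uphi (x i) else 0) => i.
case: pickP => [j /eqP /x_inj ->|/(_ i)]; last by rewrite eqxx.
by rewrite divfK// gt_eqF// uphi_node_gt0.
Qed.

Variables (k h : R -> R -> R) (sigma : R -> R).
Hypotheses (hhmeas : measurable_in_x h).
Variable Mh : R.
Hypothesis hMh : forall y, y \in `]-1, 1[ ->
  ((uphi y)%:E * \int[mu]_(t in I) (`|h t y| * (u t)^-1)%:E <= Mh%:E)%E.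

Section KernelIntegral.
Variables (y : R) (yI : y \in `]-1, 1[).

Let habs t := `|h t y| * (u t)^-1.

Let habs_ge0 t : 0 <= habs t.
Proof. by rewrite mulr_ge0// invr_ge0 mulr_ge0 ?powR_ge0. Qed.

Let measurable_habs : measurable_fun I habs.
Proof.
apply: measurable_realfun.measurable_funM; first by apply: measurableT_comp => //; exact: hhmeas.
rewrite (_ : (fun t => (u t)^-1) = (fun t : R => (1 - t) `^ (- g) * (1 + t) `^ (- d))); last first.
  by apply/funext => t; rewrite !powRN invfM.
apply: measurable_realfun.measurable_funM.
  apply: (measurableT_comp (measurable_realfun.measurable_powR (- g))).
  exact: measurable_realfun.measurable_funB.
apply: (measurableT_comp (measurable_realfun.measurable_powR (- d))).
exact: measurable_realfun.measurable_funD.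
Qed.

(** Since [uphi y] is positive, an infinite integral would make the left side of [hMh] equal to
    +oo. *)
Let integrable_habs : mu.-integrable I (EFin \o habs).
Proof.
apply/integrableP; split; first exact/measurable_realfun.measurable_EFinP.
have -> : (\int[mu]_(t in I) `|(EFin \o habs) t|)%E = (\int[mu]_(t in I) (habs t)%:E)%E.
  by apply: eq_integral => t _ /=; rewrite ger0_norm.
rewrite ltey; apply/negP => /eqP E.
have := hMh yI; rewrite /habs in E; by rewrite E gt0_muley ?lte_fin ?uphi_gt0.
Qed.

Let kint_integrand q t := h t y * (q.[t] * phi t).

Let kint_dominated q B : (forall t, t \in `[(-1), 1] -> `|q.[t]| * uphi t <= B) ->
  forall t, I t -> `|kint_integrand q t| <= B * habs t.
Proof.
move=> qB t /= tI; have B0 : 0 <= B.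
  by apply: le_trans (qB _ tI); rewrite mulr_ge0// uphi_ge0.
(* At the endpoints [u] may be 0, with inverse 0 by convention, so [u] cannot be cancelled; there
   [phi] vanishes instead. *)
have [t1|t1] := boolP (t \in `]-1, 1[); last first.
  suff p0 : phi t = 0 by rewrite /kint_integrand p0 mulr0 mulr0 normr0 mulr_ge0.
  move: tI t1; rewrite !in_itv/= => /andP[l1 l2]; rewrite negb_and -!leNgt => /orP[l3|l3].
    by rewrite (_ : t = -1) ?/phi ?sqrrN ?expr1n ?subrr ?sqrtr0//; lra.
  by rewrite (_ : t = 1) ?/phi ?expr1n ?subrr ?sqrtr0//; lra.
have u0 := jacobi_gt0 g d t1; have p0 := phi_gt0 t1.
rewrite /kint_integrand /habs !normrM (ger0_norm (ltW p0)) [leRHS]mulrCA ler_wpM2l//.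
by rewrite ler_pdivlMr// -mulrA (mulrC (phi t)) qB.
Qed.

Let measurable_kint q : measurable_fun I (kint_integrand q).
Proof.
apply: measurable_realfun.measurable_funM; first exact: hhmeas.
have cq : {within I, continuous (fun t => q.[t] * phi t)}.
  apply: continuous_subspaceT => t.
  by apply: cvgM; [exact: continuous_horner|exact: continuous_phi].
by have /integrableP[/measurable_realfun.measurable_EFinP] := continuous_integrable_segment cq.
Qed.

Let kint_integrable_bounded q B : (forall t, t \in `[(-1), 1] -> `|q.[t]| * uphi t <= B) ->
  mu.-integrable I (EFin \o kint_integrand q).
Proof.
move=> qB.
have i2 : mu.-integrable I (EFin \o (fun t => B * habs t)) by exact: integrableZl integrable_habs.
apply: (le_integrable _ _ _ i2).
- exact: measurable_itv.
- apply/measurable_realfun.measurable_EFinP. exact: measurable_kint.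
- move=> t tI; rewrite lee_fin (le_trans (kint_dominated qB tI))//.
  exact: ler_norm.
Qed.

Definition kint q : R := (\int[mu]_(t in I) kint_integrand q t)%R.

Lemma kint_le q B : (forall t, t \in `[(-1), 1] -> `|q.[t]| * uphi t <= B) ->
  `|kint q| * uphi y <= B * Mh.
Proof.
move=> qB; have B0 : 0 <= B.
  by apply: le_trans (qB 0 _); rewrite ?in_itv/= ?lerN10 ?ler01// mulr_ge0// uphi_ge0.
have intk := kint_integrable_bounded qB.
have H1 : `|kint q| <= B * (\int[mu]_(t in I) habs t)%R.
  rewrite -RintegralZl//; apply: le_trans (le_normr_Rintegral _ intk) _ => //.
  apply: le_Rintegral => //.
  - exact: integrable_norm.
  - exact: integrableZl integrable_habs.
  - exact: kint_dominated.
have H2 : uphi y * (\int[mu]_(t in I) habs t)%R <= Mh.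
  rewrite -lee_fin EFinM; have := hMh yI; congr (_ <= _)%E; congr (_ * _)%E.
  by rewrite /Rintegral fineK//; exact: integrable_fin_num.
apply: le_trans (ler_wpM2r (uphi_ge0 y) H1) _.
by rewrite -mulrA ler_wpM2l// mulrC.
Qed.

(** A polynomial of degree below m is its own interpolant, so the Lebesgue bound supplies the
    uniform bound on [q uphi] that domination requires. *)
Let kint_integrable (q : {poly R}) : (size q <= m)%N -> mu.-integrable I (EFin \o kint_integrand q).
Proof.
move=> sq; pose B := \sum_(i < m) `|q.[x i]| * uphi (x i).
apply: (@kint_integrable_bounded _ (lebesgue_bound * B)) => t tI.
rewrite -(interp_poly x_inj sq); apply: interp_uphi_le => //.
  by apply: sumr_ge0 => i _; rewrite mulr_ge0// uphi_ge0.
move=> i; rewrite /B (bigD1 i)//= lerDl.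
by apply: sumr_ge0 => j _; rewrite mulr_ge0// uphi_ge0.
Qed.

Let size_orthonormal_sum (b : nat -> R) n :
  (size (\sum_(j < n) b j *: p j)%R <= n)%N.
Proof.
apply: (leq_trans (size_sum _ _ _)); apply/bigmax_leqP => j _.
by apply: (leq_trans (size_scale_leq _ _)); case: hp => ->.
Qed.

Lemma kint_sum (b : nat -> R) n : (n <= m)%N ->
  kint (\sum_(j < n) b j *: p j) = \sum_(j < n) b j * cj p h j y.
Proof.
elim: n => [_|n IHn nm].
  rewrite !big_ord0 /kint /kint_integrand.
  by under eq_Rintegral do rewrite horner0 mul0r mulr0; rewrite Rintegral_cst// mul0r.
rewrite !big_ord_recr/= -(IHn (ltnW nm)) /cj -RintegralZl//; last first.
  have := kint_integrable (q := p n); case: (hp) => -> _ _ /(_ nm).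
  by congr integrable; apply/funext => t /=; rewrite /kint_integrand mulrA.
rewrite -RintegralD//; last 2 first.
- apply: kint_integrable; exact: leq_trans (size_orthonormal_sum b n) (ltnW nm).
- have : mu.-integrable I (EFin \o kint_integrand (b n *: p n)).
    by apply: kint_integrable; rewrite (leq_trans (size_scale_leq _ _))//; case: hp => ->.
  by apply: eq_integrable => // t _ /=; rewrite /kint_integrand hornerZ; congr EFin; ring.
by apply: eq_Rintegral => t _; rewrite /kint_integrand hornerD hornerZ; ring.
Qed.

End KernelIntegral.

End CollocationMatrix.

(** * The matrix as the collocation operator on weighted node values *)

Section CollocationSystem.
Context {R : realType}.
Let mu := @lebesgue_measure R.
Variables (p : nat -> {poly R}) (hp : orthonormal_phi p).
Variables (m : nat) (x : 'I_m -> R).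
Hypotheses (x_inj : injective x) (px0 : forall i, root (p m) (x i)).
Variables (g d : R) (gI : 0 <= g <= 2^-1) (dI : 0 <= d <= 2^-1).
Implicit Types (q : {poly R}).

Local Notation u := (jacobi g d).
Local Notation wt := (uphi g d).
Local Notation I := (`[(-1), 1]%classic : set R).

Variables (k h : R -> R -> R) (sigma : R -> R).
Hypotheses (hhmeas : measurable_in_x h).
Variable Mh : R.
Hypothesis hMh : forall y, y \in `]-1, 1[ ->
  ((wt y)%:E * \int[mu]_(t in I) (`|h t y| * (u t)^-1)%:E <= Mh%:E)%E.

Local Notation lam := (christoffel x).
Local Notation T := (Tm x sigma k h).

Let wint_coef q j : (size q <= m)%N -> (j < m)%N ->
  wint (q * p j) = \sum_(l < m) lam l * q.[x l] * (p j).[x l].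
Proof.
move=> sq jm; rewrite (gauss_quadrature x_inj hp px0).
  by apply: eq_bigr => l _; rewrite hornerM mulrA.
rewrite (leq_trans (size_polyMleq _ _))// (_ : size (p j) = j.+1); last by case: hp.
by rewrite addnS/= -addnn leq_add// ltnW.
Qed.

Let sum_coef_nodes q (c : nat -> R) : (size q <= m)%N ->
  \sum_(j < m) wint (q * p j) * c j =
  \sum_(l < m) lam l * q.[x l] * \sum_(j < m) (p j).[x l] * c j.
Proof.
move=> sq; under eq_bigr => j _ do rewrite wint_coef// mulr_suml.
rewrite exchange_big/=; apply: eq_bigr => l _; rewrite mulr_sumr.
by apply: eq_bigr => j _; rewrite mulrA.
Qed.

Lemma DAphi_nodes q y : (size q <= m)%N -> y \in `]-1, 1[ ->
  DAphi (horner q) y =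
  \sum_(l < m) lam l * q.[x l] * \sum_(j < m) (p j).[x l] * (j.+1%:R * (p j).[y]).
Proof.
move=> sq yI; rewrite {1}(orthonormal_expansion hp sq).
rewrite (DAphi_orthonormal hp (fun j : 'I_m => wint (q * p j)) yI) horner_sum.
rewrite -(sum_coef_nodes (fun j => j.+1%:R * (p j).[y]) sq).
by apply: eq_bigr => j _; rewrite hornerZ mulrA.
Qed.

(** Interpolating the kernel first makes the integrand a polynomial of degree at most 2m - 2, so
    quadrature is exact and sees only the values of [k] at the nodes. *)
Lemma Kmop_nodes q y : (size q <= m)%N ->
  Kmop x k (horner q) y = pi^-1 * \sum_(l < m) lam l * q.[x l] * k (x l) y.
Proof.
move=> sq; rewrite /Kmop /Kop; congr (_ * _).
transitivity (wint (interp x (k^~ y) * q)).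
  by rewrite /wint; apply: eq_Rintegral => t _; rewrite hornerM mulrA.
rewrite (gauss_quadrature x_inj hp px0); last first.
  by rewrite (leq_trans (size_polyMleq _ _))// -addnn (leq_trans (leq_pred _))// leq_add// size_interp.
by apply: eq_bigr => l _; rewrite hornerM interp_node//; ring.
Qed.

Lemma Kop_nodes q y : (size q <= m)%N -> y \in `]-1, 1[ ->
  Kop h (horner q) y =
  pi^-1 * \sum_(l < m) lam l * q.[x l] * \sum_(j < m) (p j).[x l] * cj p h j y.
Proof.
move=> sq yI; rewrite /Kop; congr (_ * _).
rewrite -(sum_coef_nodes (fun j => cj p h j y) sq).
rewrite -(kint_sum hp x_inj px0 gI dI hhmeas hMh yI (fun j => wint (q * p j)) (leqnn m)).
by rewrite -(orthonormal_expansion hp sq).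
Qed.

Lemma Tm_node q i : T (horner q) (x i) =
  sigma (x i) * phi (x i) * q.[x i] + DAphi (horner q) (x i)
  + Kmop x k (horner q) (x i) + Kop h (horner q) (x i).
Proof. by rewrite /Tm !interp_node. Qed.

Let uphi_node_neq0 i : wt (x i) != 0.
Proof. by rewrite gt_eqF// (uphi_node_gt0 hp x_inj px0). Qed.

Lemma Abar_row q i : (size q <= m)%N ->
  \sum_(l < m) Abar x p u sigma k h i l * (wt (x l) * q.[x l]) =
  wt (x i) * T (horner q) (x i).
Proof.
move=> sq; have xiI := node_itv hp x_inj px0 i.
rewrite Tm_node (DAphi_nodes sq xiI) (Kmop_nodes _ sq) (Kop_nodes sq xiI).
under eq_bigr do rewrite !mxE mulrDl.
rewrite big_split/= (bigD1 i)//= eqxx mulr1n big1 ?addr0; last first.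
  by move=> l li; rewrite eq_sym (negbTE li) mulr0n mul0r.
rewrite -!addrA (mulrDr (wt _)); congr (_ + _); first by rewrite /uphi; ring.
pose S1 l := \sum_(j < m) (p j).[x l] * (j.+1%:R * (p j).[x i]).
pose S2 l := \sum_(j < m) (p j).[x l] * cj p h j (x i).
have -> : \sum_(l < m) lam l * q.[x l] * S1 l +
    (pi^-1 * (\sum_(l < m) lam l * q.[x l] * k (x l) (x i)) +
     pi^-1 * (\sum_(l < m) lam l * q.[x l] * S2 l)) =
    \sum_(l < m) lam l * q.[x l] * (S1 l + pi^-1 * k (x l) (x i) + pi^-1 * S2 l).
  rewrite !mulr_sumr addrA -!big_split/=; apply: eq_bigr => l _.
  by rewrite !mulrDr !(mulrCA _ pi^-1).
rewrite mulr_sumr; apply: eq_bigr => l _.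
have -> : \sum_(j < m) (p j).[x l] * (j.+1%:R * (p j).[x i] + pi^-1 * cj p h j (x i)) =
    S1 l + pi^-1 * S2 l.
  rewrite /S1 /S2 mulr_sumr -big_split/=; apply: eq_bigr => j _.
  by rewrite mulrDr; congr (_ + _); rewrite mulrCA.
move: (S1 l) (S2 l) => s1 s2.
have := uphi_node_neq0 l; rewrite /uphi; move: (pi^-1 : R) => P.
rewrite mulf_eq0 negb_or => /andP[u0 p0].
by field; rewrite u0 p0.
Qed.

End CollocationSystem.

(** * Norms of the matrix and of its inverse *)

Section ConditionNumber.
Context {R : realType}.
Let mu := @lebesgue_measure R.
Variables (p : nat -> {poly R}) (hp : orthonormal_phi p).
Variables (m : nat) (x : 'I_m -> R) (m_gt0 : (0 < m)%N).
Hypotheses (x_inj : injective x) (px0 : forall i, root (p m) (x i)).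
Variables (g d : R) (gI : 0 <= g <= 2^-1) (dI : 0 <= d <= 2^-1).
Implicit Types (q : {poly R}).

Local Notation u := (jacobi g d).
Local Notation wt := (uphi g d).
Local Notation I := (`[(-1), 1]%classic : set R).

Variables (k h : R -> R -> R) (sigma : R -> R).
Hypotheses (hhmeas : measurable_in_x h).
Variables Mh Mk Ms : R.
Hypothesis hMh : forall y, y \in `]-1, 1[ ->
  ((wt y)%:E * \int[mu]_(t in I) (`|h t y| * (u t)^-1)%:E <= Mh%:E)%E.
Hypothesis hMk : forall t y, t \in `]-1, 1[ -> y \in `]-1, 1[ ->
  `|k t y| * wt y <= Mk.
Hypothesis hMs : forall y, y \in `]-1, 1[ -> `|sigma y * phi y| <= Ms.

Local Notation lam := (christoffel x).
Local Notation T := (Tm x sigma k h).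
Local Notation A := (Abar x p u sigma k h).
Local Notation L := (@lebesgue_bound R m).

Let wt_gt0 i : 0 < wt (x i).
Proof. exact: (uphi_node_gt0 hp x_inj px0). Qed.

Let lebesgue_bound_gt0 : 0 < L.
Proof.
rewrite mulr_gt0// /harmonic_sum; case: m m_gt0 => // n _.
by rewrite big_nat_recl//= ltr_pwDl// sumr_ge0.
Qed.

Let pi_inv_le1 : `|pi^-1 : R| <= 1.
Proof.
rewrite ger0_norm ?invr_ge0 ?pi_ge0// invf_le1 ?pi_gt0//.
by have := @pi_ge2 R; lra.
Qed.

(* The signs of a row make its sum of absolute values a value of the operator. *)
Lemma Abar_row_sum_le i : \sum_(l < m) `|A i l| <=
  Ms + 88 * m%:R * harmonic_sum m + 16 * Mk + L * Mh.
Proof.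
pose e l := Num.sg (A i l).
have e1 l : `|e l| <= 1 by rewrite normr_sg lern1 leq_b1.
have [G GE] := interp_uphi_node hp x_inj px0 g d e.
pose q := interp x G.
have sq : (size q <= m)%N by exact: size_interp.
have qE l : q.[x l] = e l / wt (x l).
  by rewrite /q interp_node// -(GE l) mulfK// gt_eqF.
have xiI := node_itv hp x_inj px0 i.
have wi0 : 0 <= wt (x i) by exact: uphi_ge0.
have -> : \sum_(l < m) `|A i l| = wt (x i) * T (horner q) (x i).
  rewrite -(Abar_row hp x_inj px0 gI dI _ _ hhmeas hMh)//; apply: eq_bigr => l _.
  by rewrite qE (mulrCA (wt (x l))) divff ?gt_eqF// mulr1 mulrC normrEsg.
rewrite Tm_node// !mulrDr.
have b1 : wt (x i) * (sigma (x i) * phi (x i) * q.[x i]) <= Ms.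
  rewrite qE (_ : _ * _ = sigma (x i) * phi (x i) * e i); last first.
    by field; rewrite gt_eqF.
  apply: (le_trans (ler_norm _)); rewrite normrM -[leRHS]mulr1.
  by apply: ler_pM => //; exact: hMs.
have b2 : wt (x i) * DAphi (horner q) (x i) <= 88 * m%:R * harmonic_sum m.
  have m2 : 0 < 2 * m%:R :> R by rewrite mulr_gt0// ltr0n.
  have xiI' : x i \in `[(-1), 1] by exact: subset_itv_oo_cc xiI.
  have := weighted_kernel_sum_le hp x_inj px0 gI dI (c := fun j => j.+1%:R) m2 xiI'
    (sine_kernel_linear_le m) (sine_kernel_linear_sin_le m).
  rewrite (_ : 44 * (2 * m%:R) = 88 * m%:R); last by ring.
  apply: le_trans; rewrite (DAphi_nodes hp x_inj px0)// mulr_sumr.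
  apply: ler_sum => l _; rewrite -[u (x i) * _]/(wt (x i)) -[u (x l) * _]/(wt (x l)).
  set S := \sum_(_ < _) _.
  rewrite qE (_ : _ * _ = (wt (x i) * (lam l / wt (x l)) * S) * e l); last first.
    by field; rewrite gt_eqF.
  apply: (le_trans (ler_norm _)); rewrite normrM -[leRHS]mulr1.
  by apply: ler_pM.
have b3 : wt (x i) * Kmop x k (horner q) (x i) <= 16 * Mk.
  rewrite (Kmop_nodes hp x_inj px0)// mulrCA.
  apply: (le_trans (ler_norm _)); rewrite normrM -[leRHS]mul1r.
  apply: ler_pM => //; rewrite mulr_sumr.
  apply: (le_trans (ler_norm_sum _ _ _)).
  have := christoffel_weight_sum_le hp x_inj px0 gI dI.
  have Mk0 : 0 <= Mk by apply: le_trans (hMk xiI xiI); rewrite mulr_ge0.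
  move=> /(ler_wpM2r Mk0); apply: le_trans; rewrite mulr_suml.
  apply: ler_sum => l _; rewrite -[u (x l) * _]/(wt (x l)).
  have l0 : 0 <= lam l by exact: (christoffel_ge0 hp x_inj px0).
  rewrite qE (_ : wt (x i) * (lam l * (e l / wt (x l)) * k (x l) (x i)) =
    (lam l / wt (x l)) * (k (x l) (x i) * wt (x i)) * e l); last first.
    by field; rewrite gt_eqF.
  rewrite normrM -[leRHS]mulr1; apply: ler_pM => //.
  rewrite normrM (ger0_norm (_ : 0 <= lam l / wt (x l))) ?divr_ge0 ?uphi_ge0//.
  rewrite ler_wpM2l ?divr_ge0 ?uphi_ge0// normrM (ger0_norm wi0).
  by apply: hMk => //; exact: (node_itv hp x_inj px0).
have b4 : wt (x i) * Kop h (horner q) (x i) <= L * Mh.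
  (* The weighted node values of [q] are signs, so [q uphi] is bounded everywhere by the Lebesgue
     constant. This accounts for the factor [L] in front of [Mh]. *)
  have qB t : t \in `[(-1), 1] -> `|q.[t]| * wt t <= L * 1.
    move=> tI; apply: (interp_uphi_le hp x_inj px0 gI dI) => // l.
    by rewrite -(ger0_norm (ltW (wt_gt0 l))) -normrM GE.
  have := kint_le hhmeas hMh xiI qB; rewrite mulr1; apply: le_trans.
  rewrite -[Kop _ _ _]/(pi^-1 * kint h (x i) q) mulrCA.
  apply: (le_trans (ler_norm _)); rewrite normrM -[leRHS]mul1r.
  by apply: ler_pM => //; rewrite normrM (ger0_norm wi0) mulrC.
lra.
Qed.

Section Inverse.
Variables (S S' : {poly_m R} -> {poly_m R}).
Hypotheses (TS : restricts T S) (S'K : cancel S' S).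

Local Notation opS' := (opnorm (g + 2^-1) (d + 2^-1) S').

(** The solution samples [uphi] times [S'] of the interpolant. With data at most [L^-1] that
    interpolant lies in the unit ball over which [opnorm] is a supremum; rescaling the data in
    advance avoids any appeal to homogeneity of [S'], which is a bare function. *)
Lemma Abar_solve (w : 'cV[R]_m) : exists2 v : 'cV[R]_m, A *m v = w &
  (forall i, `|w i 0| <= L^-1) -> forall i, (`|v i 0|%:E <= opS')%E.
Proof.
have [G GE] := interp_uphi_node hp x_inj px0 g d (fun i => w i 0).
pose q := npolyp m (interp x G).
have qE : (q : {poly R}) = interp x G by rewrite npolypK// size_interp.
exists (\col_i (wt (x i) * (S' q : {poly R}).[x i])).
  apply/matrixP => i j; rewrite ord1 mxE.
  under eq_bigr do rewrite [(\col__ _) _ _]mxE.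
  rewrite (Abar_row hp x_inj px0 gI dI _ _ hhmeas hMh) ?size_npoly//.
  rewrite TS; last exact: (node_itv hp x_inj px0).
  by rewrite S'K qE interp_node// mulrC GE.
move=> wL i; rewrite mxE normrM (ger0_norm (uphi_ge0 _ _ _)) mulrC.
have xI : x i \in `[(-1), 1] by apply: subset_itv_oo_cc; exact: (node_itv hp x_inj px0).
apply: le_trans (le_Cnorm gI dI (horner (S' q)) xI) _.
apply: ereal_sup_ubound; exists q => //=.
apply: (Cnorm_le gI dI) => y yI; rewrite qE.
rewrite -(divff (lt0r_neq0 lebesgue_bound_gt0)).
apply: (interp_uphi_le hp x_inj px0 gI dI) => //; first by rewrite invr_ge0 ltW.
by move=> l; rewrite -(ger0_norm (ltW (wt_gt0 l))) -normrM GE.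
Qed.

Lemma Abar_unit : A \in unitmx.
Proof.
have /choice[f fE] : forall l : 'I_m, exists v : 'cV[R]_m, A *m v = delta_mx l 0.
  by move=> l; have [v vE _] := Abar_solve (delta_mx l 0); exists v.
have : A *m (\matrix_(i, l) f l i 0) = 1%:M.
  apply/matrixP => i l; have /matrixP/(_ i 0) := fE l; rewrite !mxE eqxx andbT => <-.
  by apply: eq_bigr => j _; rewrite [X in _ * X]mxE.
by case/mulmx1_unit.
Qed.

Lemma opnorm_ge0 : (0 <= opS')%E.
Proof.
have [v _ vL] := Abar_solve 0.
apply: le_trans (vL _ (Ordinal m_gt0)); first by rewrite lee_fin.
by move=> i; rewrite mxE normr0 invr_ge0 ltW.
Qed.

(** The signs of the row, scaled by [L^-1], form admissible data whose solution has [i]-th entry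
    equal to the row sum divided by [L]. *)
Lemma invmx_Abar_row_sum_le i :
  ((\sum_(l < m) `|invmx A i l|)%:E <= L%:E * opS')%E.
Proof.
pose w : 'cV[R]_m := \col_l (L^-1 * Num.sg (invmx A i l)).
have [v vE vL] := Abar_solve w.
have -> : \sum_(l < m) `|invmx A i l| = L * v i 0.
  have -> : v = invmx A *m w by rewrite -vE mulKmx// Abar_unit.
  rewrite mxE mulr_sumr; apply: eq_bigr => l _.
  rewrite mxE normrEsg mulrCA (mulrA L) divff ?gt_eqF// mul1r mulrC //.
rewrite EFinM lee_pmul2l//.
apply: le_trans (vL _ i); first by rewrite lee_fin ler_norm.
move=> l; rewrite mxE normrM (ger0_norm (_ : 0 <= L^-1)); last by rewrite invr_ge0 ltW.
by rewrite ler_piMr ?invr_ge0 ?(ltW lebesgue_bound_gt0)// normr_sg lern1 leq_b1.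
Qed.

Lemma cond_Abar_le :
  (cond_inf A <= (L * (Ms + 88 * m%:R * harmonic_sum m + 16 * Mk + L * Mh))%:E * opS')%E.
Proof.
have norm_le (B : 'M[R]_m) (e : \bar R) : (0 <= e)%E ->
    (forall i, ((\sum_(l < m) `|B i l|)%:E <= e)%E) -> ((mxnorm_inf B)%:E <= e)%E.
  move=> e0 Be; rewrite /mxnorm_inf; elim/big_ind: _ => // a b ae be.
  by rewrite /Num.max; case: ifP.
rewrite /cond_inf Abar_unit EFinM.
have rb0 : 0 <= Ms + 88 * m%:R * harmonic_sum m + 16 * Mk + L * Mh.
  by apply: le_trans (Abar_row_sum_le (Ordinal m_gt0)); exact: sumr_ge0.
have nA : ((mxnorm_inf A)%:E <= (Ms + 88 * m%:R * harmonic_sum m + 16 * Mk + L * Mh)%:E)%E.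
  by apply: norm_le => // i; rewrite lee_fin; exact: Abar_row_sum_le.
have nI : ((mxnorm_inf (invmx A))%:E <= L%:E * opS')%E.
  apply: norm_le; last exact: invmx_Abar_row_sum_le.
  by rewrite mule_ge0 ?opnorm_ge0// lee_fin ltW.
rewrite (mulrC L) EFinM -muleA; apply: lee_pmul => //; rewrite lee_fin /mxnorm_inf.
  by elim/big_ind: _ => // [a b a0 b0|j _]; [rewrite le_max a0|exact: sumr_ge0].
by elim/big_ind: _ => // [a b a0 b0|j _]; [rewrite le_max a0|exact: sumr_ge0].
Qed.

End Inverse.

End ConditionNumber.

(** * Finite constants from the hypotheses, and the final arithmetic *)

Section Constants.
Context {R : realType}.
Implicit Types (f : R -> R) (a b r : R).

(** A supremum over an empty set would be -oo. The witness is [tau = 1 / (2 n)], for which the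
    interval of the modulus shrinks to the single point 0. *)
Lemma Zseminorm_ge0 n r a b f : (0 < n)%N -> (0 <= Zseminorm n r a b f)%E.
Proof.
move=> n0; have n0' : 0 < n%:R :> R by rewrite ltr0n.
apply: le_trans (ereal_sup_ubound _); last by exists 1 => //=; exact: ltr01.
rewrite mule_ge0 ?lee_fin ?powR_ge0// /Omega.
have tau1 : (2 * n%:R)^-1 <= 1 :> R.
  rewrite invf_le1 ?mulr_gt0//; have : 1 <= n%:R :> R by rewrite ler1n.
  lra.
apply: le_trans (ereal_sup_ubound _); last first.
  by exists (2 * n%:R)^-1 => //=; rewrite in_itv/= tau1 invr_gt0 mulr_gt0.
apply: le_trans (ereal_sup_ubound _); last first.
  exists 0; last by [].
  rewrite /Iset /= in_itv/=.
  have -> : 2 * (n%:R * (2 * n%:R)^-1) = 1 :> R by field; rewrite gt_eqF.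
  by rewrite expr1n subrr addNr lexx.
by rewrite lee_fin.
Qed.

Lemma ereal_sup_real_bound (A : Type) (D : set A) (F : A -> \bar R) :
  (exists2 t, D t & (0 <= F t)%E) -> (ereal_sup [set F t | t in D] < +oo)%E ->
  exists2 M : R, 0 <= M & forall t, D t -> (F t <= M%:E)%E.
Proof.
move=> [t0 Dt0 Ft0] supoo.
have sup0 : (0 <= ereal_sup [set F t | t in D])%E.
  by apply: le_trans Ft0 _; apply: ereal_sup_ubound; exists t0.
exists (fine (ereal_sup [set F t | t in D])); first exact: fine_ge0.
move=> t Dt; rewrite fineK ?ge0_fin_numE//.
by apply: ereal_sup_ubound; exists t.
Qed.

Lemma Cspace0_bounded f : Cspace 0 0 f ->
  exists2 M : R, 0 <= M & forall y, y \in `[(-1), 1] -> `|f y| <= M.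
Proof.
move=> [cf /(_ erefl) c1 /(_ erefl) cN1 _ _].
have cfW : {within `[(-1), 1], continuous f} by apply/continuous_within_itvP.
have cnW : {within `[(-1), 1], continuous (fun y => `|f y|)}.
  by move=> y; apply: cvg_norm; exact: cfW.
have [||c cI cmax] := @EVT_max R (fun y => `|f y|) (-1) 1; [by lra|by []|].
by exists `|f c|.
Qed.

Lemma condition_constant_le m (Ms Mk Mh : R) : (0 < m)%N -> 1 <= ln m%:R :> R ->
  0 <= Ms -> 0 <= Mk -> 0 <= Mh ->
  lebesgue_bound m * (Ms + 88 * m%:R * harmonic_sum m + 16 * Mk + lebesgue_bound m * Mh) <=
  88 * (Ms + 176 + 16 * Mk + 88 * Mh) * (m%:R * ln m%:R ^+ 3).
Proof.
move=> m0 l1 s0 k0 h0; have := harmonic_sum_le_ln (R := R) m0.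
have := harmonic_sum_ge0 (R := R) m; rewrite /lebesgue_bound.
have : 1 <= m%:R :> R by rewrite ler1n.
move: (m%:R : R) (harmonic_sum m : R) l1 => n H l1 n1 H0 Hl.
move: (ln n) l1 Hl => l l1 Hl.
have H2 : H <= 2 * l by lra.
have l0 : 0 <= l by lra.
have nl : 1 <= n * l by rewrite -[leLHS]mulr1; apply: ler_pM.
have r1 : Ms + 88 * n * H + 16 * Mk + 44 * H * Mh <= (Ms + 176 + 16 * Mk + 88 * Mh) * (n * l).
  have t1 : Ms <= Ms * (n * l) by rewrite ler_peMr.
  have t2 : n * H <= 2 * (n * l) by rewrite mulrCA ler_wpM2l//; lra.
  have t3 : Mk <= Mk * (n * l) by rewrite ler_peMr.
  have t4 : H * Mh <= 2 * Mh * (n * l).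
    rewrite mulrC -mulrA mulrCA ler_wpM2l//; apply: (le_trans H2).
    by rewrite ler_wpM2l// ler_peMl.
  by rewrite -[88 * n * H]mulrA -[44 * H * Mh]mulrA; lra.
have K0 : 0 <= Ms + 176 + 16 * Mk + 88 * Mh by lra.
(* [H <= 2 l] already gives [88 * l]; the second power of [l >= 1] is spent to reach the cubed
   logarithm. *)
have r2 : 44 * H <= 88 * l ^+ 2 by rewrite expr2; nra.
apply: le_trans (ler_pM _ _ r2 r1) _; first by lra.
  by rewrite !addr_ge0// !mulr_ge0//; lra.
by rewrite le_eqVlt; apply/orP; left; apply/eqP; ring.
Qed.

(** It includes the empty [D], whose infimum is +oo: the case of a collocation operator without
    inverse. *)
Lemma lee_mul_ereal_inf (c : \bar R) (K : R) (D : set (\bar R)) : 0 < K ->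
  (forall e, D e -> (c <= K%:E * e)%E) -> (c <= K%:E * ereal_inf D)%E.
Proof.
move=> K0 cD; rewrite -lee_pdivrMl//; apply: le_ereal_inf_tmp => e De.
by rewrite lee_pdivrMl// cD.
Qed.

End Constants.

Theorem theorem3p6 (R : realType) (gamma delta s r C0 : R) (ns nr : nat)
    (k h : R -> R -> R) (g sigma : R -> R)
    (p : nat -> {poly R}) (x : forall m : nat, 'I_m -> R)
    (* u = v^{gamma,delta}, and (a, b) are the exponents of u phi *)
    (u := jacobi gamma delta)
    (a := gamma + 2^-1) (b := delta + 2^-1)
    (I := `[-1, 1]%classic : set R)
    (mu := @lebesgue_measure R)
    (hgamma : 0 <= gamma < 4^-1) (hdelta : 0 <= delta < 4^-1)
    (hp : orthonormal_phi p) (hx : zeros_of p x)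
    (hs : 0 < s) (hns : s < ns%:R)
    (hr : 1 < r < s + 1) (hnr : r < nr%:R)
    (hkmeas : measurable_in_x k)
    (hhmeas : measurable_in_x h)
    (hkZ : forall t : R, t \in `[-1, 1] -> Zspace ns s a b (k t))
    (hk : (ereal_sup [set Znorm ns s a b (k t) | t in I] < +oo)%E)
    (hh : (ereal_sup [set (u y * phi y)%:E *
              \int[mu]_(t in I) (`|h t y| * (u t)^-1)%:E
            | y in I] < +oo)%E)
    (hC0 : 0 < C0)
    (hDh : forall tau : R, 0 < tau <= 2^-1 ->
       (ereal_sup [set (u y * phi y)%:E *
           \int[mu]_(t in I)
             (`|h t (y + tau * phi y / 2) - h t (y - tau * phi y / 2)|
                * (u t)^-1)%:E
         | y in Iset tau] < (C0 * tau `^ s)%:E)%E)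
    (hg : Zspace ns s a b g)
    (hsigma : exists2 F : R -> R, Zspace ns s 0 0 F &
       {in `]-1, 1[, forall y, F y = sigma y * phi y})
    (hker1 : trivial_ker nr r a b
       (fun f y => DAphi f y + Kop k f y + Kop h f y))
    (hker2 : trivial_ker nr r a b
       (fun f y => Mop sigma f y + DAphi f y + Kop k f y + Kop h f y)) :
  exists2 C : R, 0 < C &
    \forall m \near \oo,
      (cond_inf (Abar (x m) p u sigma k h) <=
         C%:E * inv_opnorm m a b (Tm (x m) sigma k h)
           * (m%:R * ln m%:R ^+ 3)%:E)%E.
Proof.
have gI : 0 <= gamma <= 2^-1 by apply/andP; split; lra.
have dI : 0 <= delta <= 2^-1 by apply/andP; split; lra.
have ns0 : (0 < ns)%N by rewrite -(ltr0n R) (lt_trans hs).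
have zeroI : (0 : R) \in `[(-1), 1] by rewrite in_itv/= lerN10 ler01.
have sub (y : R) : y \in `]-1, 1[ -> y \in `[(-1), 1] by exact: subset_itv_oo_cc.
have [Mh Mh0 hMh] : exists2 M : R, 0 <= M & forall y, I y ->
    ((u y * phi y)%:E * \int[mu]_(t in I) (`|h t y| * (u t)^-1)%:E <= M%:E)%E.
  apply: ereal_sup_real_bound hh; exists 0 => //.
  rewrite mule_ge0 ?lee_fin ?uphi_ge0// integral_ge0// => t _.
  by rewrite lee_fin mulr_ge0// invr_ge0 mulr_ge0 ?powR_ge0.
have [Mk Mk0 hMk] : exists2 M : R, 0 <= M & forall t, I t ->
    (Znorm ns s a b (k t) <= M%:E)%E.
  apply: ereal_sup_real_bound hk; exists 0 => //.
  apply: adde_ge0; last exact: Zseminorm_ge0.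
  apply: le_trans (le_Cnorm gI dI (k 0) zeroI).
  by rewrite lee_fin mulr_ge0// uphi_ge0.
have [Ms Ms0 hMs] : exists2 M : R, 0 <= M &
    forall y, y \in `]-1, 1[ -> `|sigma y * phi y| <= M.
  have [F [cF _] Fs] := hsigma; have [M M0 FM] := Cspace0_bounded cF.
  by exists M => // y yI; rewrite -Fs// FM// sub.
have hMk' t y : t \in `]-1, 1[ -> y \in `]-1, 1[ ->
    `|k t y| * uphi gamma delta y <= Mk.
  move=> tI yI; rewrite -lee_fin; apply: le_trans (hMk t (sub t tI)).
  apply: le_trans (le_Cnorm gI dI (k t) (sub y yI)) _.
  by rewrite /Znorm leeDl// Zseminorm_ge0.
pose C := 88 * (Ms + 176 + 16 * Mk + 88 * Mh).
have C0' : 0 < C by rewrite /C; lra.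
exists C => //.
near=> m.
have m0 : (0 < m)%N by near: m; exact: nbhs_infty_gt.
have lm : 1 <= ln m%:R :> R.
  rewrite -[leLHS](expRK 1) ler_ln ?posrE ?expR_gt0 ?ltr0n//.
  by near: m; exact: nbhs_infty_ger.
have [x_inj px0] := hx m.
have P0 : 0 < m%:R * ln m%:R ^+ 3 :> R.
  by rewrite mulr_gt0 ?ltr0n// exprn_gt0//; lra.
(* The scalar factors are gathered in front of the infimum, so that it suffices to treat one inverse
   [S'] at a time. *)
rewrite muleAC -EFinM; apply: lee_mul_ereal_inf; first by rewrite mulr_gt0.
move=> _ [S' [S [TS _ S'K]] <-].
have hMh' y : y \in `]-1, 1[ -> ((uphi gamma delta y)%:E *
    \int[mu]_(t in I) (`|h t y| * (u t)^-1)%:E <= Mh%:E)%E.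
  by move=> yI; apply: hMh; exact: sub.
apply: le_trans (cond_Abar_le hp m0 x_inj px0 gI dI hhmeas hMh' hMk' hMs TS S'K) _.
apply: lee_wpmul2r; last by rewrite lee_fin; exact: condition_constant_le.
exact: (opnorm_ge0 hp m0 x_inj px0 gI dI hhmeas hMh' TS S'K).
Unshelve. all: by end_near. Qed.
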